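(* Let $X$ be a noncompact, locally compact, connected, separable metrizable space. Then for any $n\in\mathbb N$ there exists a proper metric $d_n$ compatible with the topology on $X$ such that $\dim(u_{d_n}X\setminus X)=\operatorname{ind}(u_{d_n}X\setminus X)=\operatorname{Ind}(u_{d_n}X\setminus X)=n$.
   Context: $\mathbb N=\{1,2,\dots\}$. A metric $d$ on $X$ is proper if for every $x\in X$ and $r>0$ the closure in $X$ of $\{y\in X: d(x,y)<r\}$ is compact. Compactifications are Hausdorff. For a metric space $(X,d)$, let $U_d^*(X)$ be the set of all bounded uniformly continuous functions $X\to\mathbb R$. The Smirnov compactification $u_dX$ of $(X,d)$ is the compactification of $X$ associated with the closed subring $U_d^*(X)$ of $C^*(X)$ (the Banach algebra of bounded continuous real-valued functions with the sup-norm); concretely, it is the closure of $e(X)$ in $\prod_{f\in U_d^*(X)}[\inf f(X),\sup f(X)]$, where $e(x)=(f(x))_{f}$ is the evaluation map, and $X$ is identified with $e(X)$. $\dim$ is the covering dimension, $\operatorname{ind}$ the small inductive dimension and $\operatorname{Ind}$ the large inductive dimension. For a normal space $Y$: $\operatorname{Ind}Y=-1$ iff $Y=\emptyset$; for $n\ge 0$, $\operatorname{Ind}Y\le n$ iff for every pair $A,B$ of disjoint closed subsets of $Y$ there is a partition $L$ between $A$ and $B$ (a closed set $L\subset Y$ for which there are disjoint open sets $U\supset A$, $V\supset B$ with $Y\setminus L=U\cup V$) such that $\operatorname{Ind}L\le n-1$. $\operatorname{ind}$ is defined in the same way with $A$ restricted to be a single point. *)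

(* Defs.v *)
From mathcomp Require Export all_boot all_order all_algebra.
From mathcomp Require Export all_classical all_reals all_analysis.

Set Implicit Arguments.
Unset Strict Implicit.
Unset Printing Implicit Defensive.

Export Order.TTheory GRing.Theory Num.Theory.
Export numFieldNormedType.Exports.

#[global] Open Scope classical_set_scope.
#[global] Open Scope ring_scope.

Section Metrics.
Context {R : realType} {X : topologicalType}.

Record is_metric (d : X -> X -> R) : Prop := IsMetric {
  is_metric_eq0 : forall x y, d x y = 0 <-> x = y ;
  is_metric_sym : forall x y, d x y = d y x ;
  is_metric_triangle : forall x y z, d x z <= d x y + d y z }.

Definition dball (d : X -> X -> R) (x : X) (r : R) : set X :=
  [set y | d x y < r].

(* The topology of X is the one induced by d. *)
Definition compatible (d : X -> X -> R) : Prop :=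
  forall x : X, nbhs x = filter_from [set r : R | 0 < r] (dball d x).

Definition proper_metric (d : X -> X -> R) : Prop :=
  forall (x : X) (r : R), 0 < r -> compact (closure (dball d x r)).

Definition dist_unif_continuous (d : X -> X -> R) (f : X -> R) : Prop :=
  forall eps : R, 0 < eps -> exists2 delta : R, 0 < delta &
    forall x y : X, d x y < delta -> `|f x - f y| < eps.

(* The ring U_d^*(X); when d is compatible its members are continuous. *)
Definition Ustar (d : X -> X -> R) : set (X -> R) :=
  [set f | bounded_fun f /\ dist_unif_continuous d f].

End Metrics.

Definition metrizable (R : realType) (X : topologicalType) : Prop :=
  exists d : X -> X -> R, is_metric d /\ compatible d.

Definition separable (X : topologicalType) : Prop :=
  exists2 D : set X, countable D & dense D.

Section Smirnov.
Context {R : realType} {X : topologicalType}.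
Variable d : X -> X -> R.

Definition smirnov_eval (x : X) : {ptws Ustar d -> R} :=
  fun f : Ustar d => set_val f x.

Definition smirnov_cube : set {ptws Ustar d -> R} :=
  [set p | forall f : Ustar d,
    inf (range (set_val f)) <= p f <= sup (range (set_val f))].

(* u_d X, the closure of the image of X relative to the cube. *)
Definition smirnov : set {ptws Ustar d -> R} :=
  smirnov_cube `&` closure (range smirnov_eval).

(* u_d X \ X. As a type, a set carries its subspace topology. *)
Definition smirnov_remainder : set {ptws Ustar d -> R} :=
  smirnov `\` range smirnov_eval.

End Smirnov.

Arguments smirnov_eval {R X} d x.
Arguments smirnov_cube {R X} d.
Arguments smirnov {R X} d.
Arguments smirnov_remainder {R X} d.

Section Dimensions.

Definition open_cover (Y : topologicalType) (U : set (set Y)) : Prop :=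
  (forall A, U A -> open A) /\ \bigcup_(A in U) A = [set: Y].

Definition refines (Y : Type) (V U : set (set Y)) : Prop :=
  forall B, V B -> exists2 A, U A & B `<=` A.

(* No point lies in k + 1 distinct members of V. *)
Definition multiplicity_le (Y : Type) (V : set (set Y)) (k : nat) : Prop :=
  forall F : set (set Y), F `<=` V -> (F #= `I_k.+1)%card ->
    \bigcap_(A in F) A = set0.

Definition is_partition_between (Y : topologicalType) (L A B : set Y) : Prop :=
  closed L /\
  exists U V : set Y, [/\ open U, open V, A `<=` U & B `<=` V] /\
    U `&` V = set0 /\ ~` L = U `|` V.

(* The index is shifted by one so that it can be a natural number:            *)
(* dim_lt k Y, ind_lt k Y and Ind_lt k Y mean that the dimension is < k,      *)
(* i.e., <= k - 1. *)

(* Every finite open cover has a finite open refinement of order <= k - 1,    *)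
(* i.e., in which every point lies in at most k members. *)
Definition dim_lt (k : nat) (Y : topologicalType) : Prop :=
  forall U : set (set Y), finite_set U -> open_cover U ->
    exists V : set (set Y),
      [/\ finite_set V, open_cover V, refines V U & multiplicity_le V k].

Fixpoint ind_lt (k : nat) (Y : topologicalType) : Prop :=
  match k with
  | 0 => [set: Y] = set0
  | k'.+1 => forall (x : Y) (B : set Y), closed B -> ~ B x ->
      exists L : set Y, is_partition_between L [set x] B /\ ind_lt k' L
  end.

Fixpoint Ind_lt (k : nat) (Y : topologicalType) : Prop :=
  match k with
  | 0 => [set: Y] = set0
  | k'.+1 => forall A B : set Y, closed A -> closed B -> A `&` B = set0 ->
      exists L : set Y, is_partition_between L A B /\ Ind_lt k' L
  end.

Definition dim_eq (Y : topologicalType) (n : nat) : Prop :=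
  dim_lt n.+1 Y /\ ~ dim_lt n Y.

Definition ind_eq (Y : topologicalType) (n : nat) : Prop :=
  ind_lt n.+1 Y /\ ~ ind_lt n Y.

Definition Ind_eq (Y : topologicalType) (n : nat) : Prop :=
  Ind_lt n.+1 Y /\ ~ Ind_lt n Y.

End Dimensions.

(* Main.v *)
Require Import Defs.
From mathcomp Require Import fingroup perm zify ring lra.

Set Implicit Arguments.
Unset Strict Implicit.
Unset Printing Implicit Defensive.

(** Let $r$ be a positive continuous function on $X$ vanishing at infinity, and
    $f = 1/r$; as $X$ is connected and not compact, $f$ takes all large values.
    Put $T_1 = f$ and $T_i = \cos f^i$ for $1 < i \le n$, and let
    $d(x,y) = \rho(x,y) + \sum_i |T_i(x) - T_i(y)|$, where $\rho$ is a compatible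
    metric for which all points near infinity are close to each other.  Up to
    $\rho$, the space $(X,d)$ looks near infinity like a curve which is
    asymptotically dense in $[0,\infty)\times[-1,1]^{n-1}$, because $\cos f^j$
    oscillates much faster than the $\cos f^i$ with $i<j$.  Its remainder $Y$
    therefore has the dimension of that product.  Note that $Y$ is the zero set of
    the extension of $r$, so that closed conditions valid near infinity in $X$
    pass to $Y$ ([transfer]).

    Upper bounds.  Cut the space of the coordinates $T$ into cubes of side
    $2^{-m}$ by hyperplanes, and let $W_m$ be the part of $Y$ over these walls, the
    zero set of the extensions of $\cos(\pi 2^m T_i)$.  Walls of different levels
    are disjoint in each coordinate, so that no point of $Y$ belongs to more than
    $n$ of the $W_m$ ([walls_pigeonhole]).  For large $m$ the complement of $W_m$ is
    a disjoint union of open sets as small as desired ([walls_cellular]).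
    The pieces of $n+1$ levels refine a given cover with multiplicity at most
    $n+1$, whence $\dim Y\le n$; and disjoint closed sets have a partition inside
    some $W_m$, which by iteration gives $\operatorname{Ind} Y\le n$.

    Lower bounds.  Far out, the coordinates nearly fill a unit cube; a limit of
    such almost-cubes, obtained by compactness of a product, is an embedding of
    $[0,1]^n$ in $Y$ ([cube_embeds]).  It remains to prove that the covering and
    small inductive dimensions of $[0,1]^n$ are at least $n$.  The former is
    Lebesgue's covering theorem, deduced from Kuhn's version of Sperner's lemma
    ([kuhn], [cube_not_shrinkable]).  The latter follows by Aleksandrov's
    inequality $\dim\le\operatorname{ind}$ ([sind_shrinkable]), itself a
    consequence of the finite sum theorem for $\dim$.  Finally
    $\operatorname{ind}\le\operatorname{Ind}$ in a space whose points are closed. *)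

(** * Kuhn's cubical Sperner lemma *)

Section Kuhn.
Local Open Scope nat_scope.

(** The simplices of Kuhn's triangulation of the grid $\{0,\dots,N\}^n$ are
    indexed by a base point [b] and a permutation [s], where [s i] is the time
    at which the coordinate [i] is incremented.  Vertex [k] ($0\le k\le n$) is
    the point reached just before time [k]. *)
Definition kvertex (n N : nat) (b : {ffun 'I_n -> 'I_N}) (s : 'S_n) (k : nat) :
  'I_n -> nat := fun i => b i + (s i < k).

(** The $n+1$ vertices of the simplex carry each of the labels $0,\dots,n$
    exactly once. *)
Definition rainbow (n N : nat) (l : ('I_n -> nat) -> nat)
    (b : {ffun 'I_n -> 'I_N}) (s : 'S_n) : bool :=
  perm_eq [seq l (kvertex b s k) | k <- iota 0 n.+1] (iota 0 n.+1).

(** The facet obtained by omitting vertex [j] carries each of the labels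
    $0,\dots,n-1$ exactly once. *)
Definition door (n N : nat) (l : ('I_n -> nat) -> nat)
    (b : {ffun 'I_n -> 'I_N}) (s : 'S_n) (j : nat) : bool :=
  perm_eq [seq l (kvertex b s k) | k <- rem j (iota 0 n.+1)] (iota 0 n).

Lemma addb_odd_count (T : Type) (s : seq T) (P : pred T) :
  \big[addb/false]_(x <- s) P x = odd (count P s).
Proof. by elim: s => [|x s IH]; rewrite ?big_nil // big_cons IH /= oddD oddb. Qed.

(** Local form of Sperner's lemma, for any word of $n+1$ labels: the number
    of its doors is odd if and only if it is rainbow.  Indeed if one letter [c]
    can be removed to leave $0,\dots,n-1$, then the removable positions are
    exactly the occurrences of [c], and there is one of them when $c=n$ and
    two otherwise. *)
Lemma parity_doors (n : nat) (w : nat -> nat) :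
  (forall k, k <= n -> w k <= n) ->
  perm_eq [seq w k | k <- iota 0 n.+1] (iota 0 n.+1) =
  \big[addb/false]_(j <- iota 0 n.+1)
    perm_eq [seq w k | k <- rem j (iota 0 n.+1)] (iota 0 n).
Proof.
move=> wn.
have split j : j \in iota 0 n.+1 ->
    perm_eq [seq w k | k <- iota 0 n.+1]
            (w j :: [seq w k | k <- rem j (iota 0 n.+1)]).
  by move=> jn; rewrite -map_cons; apply/perm_map/perm_to_rem.
have iotaS : perm_eq (iota 0 n.+1) (n :: iota 0 n).
  by rewrite -addn1 iotaD /= add0n perm_catC.
case: (boolP (has (fun j => perm_eq [seq w k | k <- rem j (iota 0 n.+1)] (iota 0 n))
     (iota 0 n.+1))) => [/hasP[j0 j0n dj0]|/hasPn none].
- have wc : perm_eq [seq w k | k <- iota 0 n.+1] (w j0 :: iota 0 n).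
    by apply: perm_trans (split _ j0n) _; rewrite perm_cons.
  rewrite (eq_big_seq (fun j => w j == w j0)); last first.
    move=> j jn /=; apply/idP/idP => [dj|/eqP wj].
      have : perm_eq (w j :: iota 0 n) (w j0 :: iota 0 n).
        rewrite -(permPr wc) perm_sym; apply: perm_trans (split _ jn) _.
        by rewrite perm_cons.
      move/seq.permP/(_ (pred1 (w j))) => /=; rewrite eqxx.
      by rewrite eq_sym; case: eqP => // _; lia.
    have := split _ jn; rewrite (permPl wc) -wj perm_cons.
    by rewrite perm_sym.
  rewrite addb_odd_count -(count_map w (pred1 (w j0))).
  move/seq.permP: (wc) => -> /=; rewrite eqxx (count_uniq_mem _ (iota_uniq _ _)).
  rewrite mem_iota add0n leq0n andTb oddS oddb.
  have : w j0 <= n by apply: wn; move: j0n; rewrite mem_iota.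
  rewrite leq_eqVlt => /orP[/eqP e|lt].
    by rewrite (permPl wc) e ltnn perm_sym.
  rewrite lt; apply/negP => p.
  have := seq.permP wc (pred1 (w j0)); rewrite (seq.permP p).
  have -> : 0 :: iota 1 n = iota 0 n.+1 by [].
  rewrite [RHS]/= eqxx !(count_uniq_mem _ (iota_uniq _ _)) !mem_iota; lia.
- rewrite big1_seq; last by move=> j /= /none /negbTE.
  apply/negP => p.
  have : n \in [seq w k | k <- iota 0 n.+1].
    by rewrite (perm_mem p) mem_iota /= add0n ltnSn.
  case/mapP => j jn wj; have /negP := none _ jn; apply.
  rewrite -(perm_cons n) {1}wj -(permPl (split _ jn)) (permPl p).
  by rewrite (permPl iotaS).
Qed.

(** The permutations cancel in pairs [s], [s * tperm i j], of which exactly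
    one is even. *)
Lemma addb_tperm0 (n : nat) (F : 'S_n -> bool) (i j : 'I_n) :
  i != j -> (forall s, F (s * tperm i j)%g = F s) ->
  \big[addb/false]_(s : 'S_n) F s = false.
Proof.
move=> ij Fs; rewrite (bigID (fun s : 'S_n => odd_perm s)) /=.
rewrite [X in X (+) _](reindex_inj (mulIg (tperm i j))) /=.
under eq_bigl => s do rewrite odd_permM odd_tperm ij addbT.
under eq_bigr => s _ do rewrite Fs.
by rewrite addbb.
Qed.


(** Kuhn's boundary condition; the coordinates are numbered from 0 and the
    labels [i.+1] correspond to the coordinates. *)
Definition kuhn_labelling (n N : nat) (l : ('I_n -> nat) -> nat) : Prop :=
  forall x : 'I_n -> nat, (forall i, x i <= N) ->
  [/\ l x <= n, (forall i, x i = 0 -> l x <> i.+1)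
    & (forall i, x i = N -> i < l x)].

Lemma kvertex_le (n N : nat) (b : {ffun 'I_n -> 'I_N}) (s : 'S_n) k i :
  kvertex b s k i <= N.
Proof. rewrite /kvertex; have := ltn_ord (b i); case: (_ < k); lia. Qed.

Lemma door_missing (n N : nat) (l : ('I_n -> nat) -> nat)
    (b : {ffun 'I_n -> 'I_N}) (s : 'S_n) (j c : nat) : c < n ->
  (forall k, k \in rem j (iota 0 n.+1) -> l (kvertex b s k) <> c) ->
  door l b s j = false.
Proof.
move=> cn H; apply/negP => /perm_mem/(_ c).
by rewrite mem_iota /= add0n cn => /mapP[k /H + /esym].
Qed.

Lemma rem_last (n : nat) : rem n (iota 0 n.+1) = iota 0 n.
Proof.
rewrite rem_filter ?iota_uniq // -addn1 iotaD filter_cat /= add0n eqxx cats0.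
apply/all_filterP/allP => k; rewrite mem_iota /= => kn; lia.
Qed.

Lemma lift_perm_inj (m : nat) : injective (@lift_perm m ord_max ord_max).
Proof.
move=> s t /permP e; apply/permP => k; apply: (@lift_inj _ ord_max).
by have := e (lift ord_max k); rewrite !lift_perm_lift.
Qed.

Lemma lift_perm_onto (m : nat) (s : 'S_m.+1) : s ord_max = ord_max ->
  exists s0 : 'S_m, lift_perm ord_max ord_max s0 = s.
Proof.
move=> sm; pose g k := odflt k (unlift ord_max (s (lift ord_max k))).
have gE k : lift ord_max (g k) = s (lift ord_max k).
  rewrite /g; case: unliftP => //= e.
  have /perm_inj/eqP : s (lift ord_max k) = s ord_max by rewrite e sm.
  by rewrite eq_sym (negbTE (neq_lift _ _)).
have g_inj : injective g.
  by move=> k k' /(congr1 (lift ord_max)); rewrite !gE => /perm_inj/lift_inj.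
exists (perm g_inj); apply/permP => i.
case: (unliftP ord_max i) => [k|] ->; last by rewrite lift_perm_id sm.
by rewrite lift_perm_lift permE gE.
Qed.

(** The number of rainbow simplices is odd.  The doors are counted in two
    ways, the facets interior to the grid cancelling in pairs; by the boundary
    condition the doors on the boundary all lie on the face where the last
    coordinate vanishes, where they are the rainbow simplices of one dimension
    less. *)
Lemma kuhn_parity (N : nat) : 0 < N -> forall n l, @kuhn_labelling n N l ->
  \big[addb/false]_(b : {ffun 'I_n -> 'I_N})
     \big[addb/false]_(s : 'S_n) rainbow l b s.
Proof.
move=> N0; elim=> [|m IH] l lP.
  have rT (b : {ffun 'I_0 -> 'I_N}) s : rainbow l b s = true.
    rewrite /rainbow /=; have [] := lP (kvertex b s 0); first by case.
    by rewrite leqn0 => /eqP-> _ _.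
  under eq_bigr => b _ do under eq_bigr => s _ do rewrite rT.
  rewrite !big_const /= card_Sn.
  by rewrite card_ffun !card_ord expn0.
set n := m.+1.
(* the cyclic shift of time, used to identify facet 0 with facet n of a neighbour *)
pose cy : 'S_n := perm (@ord_pred_inj n).
have lv (b : {ffun 'I_n -> 'I_N}) s k : l (kvertex b s k) <= n.
  by have [] := lP (kvertex b s k) (kvertex_le b s k).
have -> : \big[addb/false]_(b : {ffun 'I_n -> 'I_N})
     \big[addb/false]_(s : 'S_n) rainbow l b s =
   \big[addb/false]_(b : {ffun 'I_n -> 'I_N})
     \big[addb/false]_(s : 'S_n) (door l b s 0 (+) door l b s n).
  apply: eq_bigr => b _.
  transitivity (\big[addb/false]_(s : 'S_n)
      \big[addb/false]_(j <- iota 0 n.+1) door l b s j).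
    apply: eq_bigr => s _.
    by apply: (parity_doors (w := fun k => l (kvertex b s k))) => k _; exact: lv.
  rewrite exchange_big // big_split.
  have -> : iota 0 n.+1 = 0 :: iota 1 m ++ [:: n].
    by rewrite -[n.+1]/(1 + m.+1) -[m.+1 in LHS]addn1 !iotaD.
  rewrite big_cons big_cat /= big_seq1; congr (_ (+) _).
  (* omitting vertex j with 0 < j < n: exchanging times j - 1 and j keeps the facet *)
  rewrite big1_seq ?addFb // => j /=; rewrite mem_iota => jm.
  have j1 : j.-1 < n by lia.
  have j2 : j < n by lia.
  apply: (@addb_tperm0 _ _ (Ordinal j1) (Ordinal j2)).
    by rewrite -val_eqE /=; lia.
  move=> s; rewrite /door; congr (perm_eq _ _).
  apply/eq_in_map => k; rewrite mem_rem_uniq ?iota_uniq // inE /= => /andP[kj _].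
  congr (l _); apply: funext => i; rewrite /kvertex permM; congr (_ + _).
  case: tpermP => [->|->|//] /=; congr nat_of_bool; lia.
under eq_bigr => b _ do rewrite big_split /=.
rewrite big_split /= exchange_big //=.
(* [sh s b] moves the base point one step in the direction incremented first,
   cyclically, so that it is a bijection *)
pose sh (s : 'S_n) (b : {ffun 'I_n -> 'I_N}) : {ffun 'I_n -> 'I_N} :=
  [ffun i => if s i == ord0 then ordS (b i) else b i].
have sh_inj s : injective (sh s).
  move=> b b' /ffunP e; apply/ffunP => i; have := e i; rewrite !ffunE.
  by case: ifP => // _; exact: ordS_inj.
(* facet 0 is facet n of the next simplex, unless that one has wrapped around,
   in which case facet 0 lies on a face x_i = N and misses the label 0 *)
have D0 s b : door l b s 0 =
    door l (sh s b) (s * cy)%g n && (sh s b ((s * cy)^-1%g ord_max) != 0 :> nat).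
  set i0 := (s^-1)%g ord0.
  have si0 : s i0 = ord0 by rewrite /i0 permKV.
  have -> : ((s * cy)^-1)%g ord_max = i0.
    apply: (@perm_inj _ (s * cy)%g); rewrite permKV permM si0 permE.
    by apply: val_inj; rewrite /= modn_small //; lia.
  rewrite /sh ffunE si0 eqxx /=.
  have [wr|nwr] := eqVneq (b i0).+1 N.
    rewrite wr modnn /= andbF; apply: (door_missing (c := 0)) => // k.
    have -> : rem 0 (iota 0 n.+1) = iota 1 n by [].
    rewrite mem_iota => k1.
    have [_ _ /(_ i0)] := lP (kvertex b s k) (kvertex_le b s k).
    rewrite /kvertex si0 /=; have -> : (0 < k) by lia.
    by rewrite addn1 => /(_ wr); lia.
  have bN : (b i0).+1 < N by rewrite ltn_neqAle nwr /= ltn_ord.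
  rewrite modn_small // andbT /door rem_last.
  have -> : rem 0 (iota 0 n.+1) = iota (1 + 0) n by [].
  rewrite iotaDl -map_comp; congr (perm_eq _ _).
  apply/eq_in_map => k; rewrite mem_iota => kn /=.
  congr (l _); apply: funext => i; rewrite /kvertex permM permE !ffunE.
  have [e|ne] := eqVneq (s i) ord0.
    have -> : i = i0 by rewrite /i0 -e permK.
    rewrite si0 /= modn_small // modn_small; last lia.
    have -> : (m < k) = false by rewrite /n in kn; lia.
    by rewrite addn0 addn1.
  have : (s i : nat) != 0 by apply: contra_neq ne => e; exact: val_inj.
  rewrite /= => sp; have := ltn_ord (s i) => sn.
  have -> : (s i + m.+1).-1 = (s i).-1 + m.+1 by lia.
  rewrite modnDr modn_small; last lia.
  by congr (_ + nat_of_bool _); lia.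
have -> : \big[addb/false]_(s : 'S_n)
    \big[addb/false]_(b : {ffun 'I_n -> 'I_N}) door l b s 0 =
  \big[addb/false]_(s : 'S_n) \big[addb/false]_(b : {ffun 'I_n -> 'I_N})
    (door l b s n && (b (s^-1%g ord_max) != 0 :> nat)).
  rewrite [RHS](reindex_inj (mulIg cy)) /=; apply: eq_bigr => s _.
  rewrite [RHS](reindex_inj (@sh_inj s)) /=; apply: eq_bigr => b _.
  exact: D0.
rewrite [X in _ (+) X]exchange_big //= -big_split /=.
under eq_bigr => s _ do rewrite -big_split /=.
(* the doors that remain lie on a face x_i = 0 and miss the label i + 1, unless
   i is the last coordinate *)
have E s (b : {ffun 'I_n -> 'I_N}) :
    (door l b s n && (b (s^-1%g ord_max) != 0 :> nat)) (+) door l b s n =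
    [&& s ord_max == ord_max, b ord_max == 0 :> nat & door l b s n].
  set i0 := (s^-1)%g ord_max.
  have si0 : s i0 = ord_max by rewrite /i0 permKV.
  have [e|ne] := eqVneq i0 ord_max.
    have -> : s ord_max == ord_max by rewrite -{1}e si0.
    rewrite e /=; case: (door _ _ _ _); case: eqP => //.
  have -> /= : (s ord_max == ord_max) = false.
    apply/negP => /eqP e; move/eqP: ne; apply; apply: (@perm_inj _ s).
    by rewrite si0 e.
  have [b0|b0] /= := eqVneq (b i0 : nat) 0; last by rewrite andbT addbb.
  rewrite andbF addFb.
  have i0m : i0 < m.
    have := ltn_ord i0; rewrite ltnS leq_eqVlt => /orP[/eqP e|//].
    by case/eqP: ne; apply: val_inj.
  apply: (door_missing (c := i0.+1)); first by rewrite ltnS.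
  move=> k; rewrite rem_last mem_iota => kn.
  have [_ + _] := lP (kvertex b s k) (kvertex_le b s k); apply.
  rewrite /kvertex si0 b0 /=.
  by have -> : (m < k) = false by rewrite ?/n in kn; lia.
under eq_bigr => s _ do under eq_bigr => b _ do rewrite E.
(* the simplices of that face, as simplices of the grid of dimension m *)
pose ex (y : 'I_m -> nat) : 'I_n -> nat :=
  fun i => if unlift ord_max i is Some i' then y i' else 0.
pose exb (b : {ffun 'I_m -> 'I_N}) : {ffun 'I_n -> 'I_N} :=
  [ffun i => if unlift ord_max i is Some i' then b i' else Ordinal N0].
have lP' : @kuhn_labelling m N (l \o ex).
  move=> x xN; have exN i : ex x i <= N by rewrite /ex; case: unlift => [i'|] //=.
  have [l1 l2 l3] := lP (ex x) exN.
  have exl i : ex x (lift ord_max i) = x i by rewrite /ex liftK.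
  have vl (i : 'I_m) : lift ord_max i = i :> nat by rewrite lift_max.
  split=> /=.
  - rewrite -ltnS ltn_neqAle l1 andbT; apply/eqP.
    by apply: (l2 ord_max); rewrite /ex unlift_none.
  - by move=> i xi; rewrite -vl; apply: l2; rewrite exl.
  - by move=> i xi; rewrite -vl; apply: l3; rewrite exl.
rewrite exchange_big //= /is_true; apply: etrans (IH _ lP').
transitivity (\big[addb/false]_(b : {ffun 'I_n -> 'I_N} | b ord_max == Ordinal N0)
   \big[addb/false]_(s : 'S_n | s ord_max == ord_max) door l b s n).
  rewrite [RHS]big_mkcond; apply: eq_bigr => b _.
  rewrite -val_eqE /=; case: ifP => [_|_]; last by rewrite big1 // => s _; rewrite andbF.
  by rewrite [RHS]big_mkcond; apply: eq_bigr => s _; case: ifP.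
rewrite (reindex exb) /=; last first.
  exists (fun b : {ffun 'I_n -> 'I_N} => [ffun i => b (lift ord_max i)]).
    by move=> b _; apply/ffunP => i; rewrite !ffunE liftK.
  move=> b; rewrite inE => /eqP b0; apply/ffunP => i; rewrite !ffunE.
  by case: unliftP => [j|] -> //; rewrite ffunE.
apply: eq_big => [b|b _]; first by rewrite ffunE unlift_none eqxx.
rewrite (reindex (lift_perm ord_max ord_max)) /=; last first.
  have /choice[h hP] (s : 'S_n) : exists s0 : 'S_m,
      s ord_max = ord_max -> lift_perm ord_max ord_max s0 = s.
    have [/lift_perm_onto[s0 <-]|ne] := pselect (s ord_max = ord_max).
      by exists s0.
    by exists 1%g.
  exists h => [s0 _|s /eqP/hP//]; apply: lift_perm_inj.
  by apply: hP; rewrite lift_perm_id.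
apply: eq_big => [s|s _]; first by rewrite lift_perm_id eqxx.
rewrite /door /rainbow rem_last; congr (perm_eq _ _).
apply/eq_in_map => k; rewrite mem_iota => km /=.
congr (l _); apply: funext => i; rewrite /kvertex /ex ffunE.
case: unliftP => [j|] ->; first by rewrite lift_perm_lift lift_max.
by rewrite lift_perm_id /=; have -> : (m < k) = false by lia.
Qed.

(** Kuhn's cubical Sperner lemma: some unit cube of the grid carries all the
    labels. *)
Lemma kuhn (n N : nat) (l : ('I_n -> nat) -> nat) : 0 < N ->
  kuhn_labelling N l ->
  exists v : 'I_n.+1 -> 'I_n -> nat,
   [/\ forall j, l (v j) = j, forall j i, v j i <= N
     & forall j j' i, v j i <= (v j' i).+1].
Proof.
move=> N0 lP.
have [b [s rb]] : exists b : {ffun 'I_n -> 'I_N}, exists s, rainbow l b s.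
  apply: contrapT => no; have := kuhn_parity N0 lP.
  rewrite big1 // => b _; rewrite big1 // => s _; apply/negbTE/negP => r.
  by apply: no; exists b, s.
have vj (j : 'I_n.+1) : exists k, l (kvertex b s k) = j.
  have : (j : nat) \in [seq l (kvertex b s k) | k <- iota 0 n.+1].
    by rewrite (perm_mem rb) mem_iota /= add0n.
  by case/mapP => k _ e; exists k.
have [k kP] := choice vj.
exists (fun j => kvertex b s (k j)); split=> // [j i|j j' i].
  exact: kvertex_le.
rewrite /kvertex; case: (s i < k j); case: (s i < k j'); lia.
Qed.

End Kuhn.

(** * Shrinkings of open covers and inductive dimension *)

Lemma compact_fin_subcover (T : topologicalType) (A : set T) (I : eqType)
    (U : I -> set T) :
  compact A -> (forall i, open (U i)) -> (forall x, A x -> exists i, U i x) ->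
  exists s : seq I, forall x, A x -> exists2 i, i \in s & U i x.
Proof.
move=> /compact_near_coveringP cA oU AU.
pose F : set_system (seq I) :=
  filter_from setT (fun s : seq I => [set s' : seq I | {subset s <= s'}]).
have FF : Filter F.
  apply: filter_from_filter; first by exists [::].
  move=> s t _ _; exists (s ++ t) => // u su.
  by split=> i it; apply: su; rewrite mem_cat it ?orbT.
have := cA _ F (fun s x => exists2 i, i \in s & U i x) FF.
case=> [x Ax|s _ sP].
  have [i Ux] := AU x Ax.
  exists (U i, [set s : seq I | i \in s]).
    split=> /=; first exact: open_nbhs_nbhs.
    by exists [:: i] => // s; apply; rewrite inE.
  by move=> [y s] /= [Uy si]; exists i.
by exists s => x Ax; apply: (sP s).
Qed.

Lemma open_allin (T : topologicalType) (I : eqType) (s : seq I) (B : I -> set T) :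
  (forall i, i \in s -> open (B i)) -> open [set z | forall i, i \in s -> B i z].
Proof.
elim: s => [|i s IH] oB.
  by rewrite (_ : [set _ | _] = setT) ?predeqE //; exact: openT.
rewrite (_ : [set _ | _] = B i `&` [set z | forall i, i \in s -> B i z]).
  apply: openI; first by apply: oB; rewrite inE eqxx.
  by apply: IH => j js; apply: oB; rewrite inE js orbT.
rewrite predeqE => z; split=> [H|[Bi H] j].
  by split=> [|j js]; apply: H; rewrite inE ?eqxx ?js ?orbT.
by rewrite inE => /predU1P[->|/H].
Qed.

Section Shrink.
Variables (R : realType) (M : normedModType R) (J : finType).

(** The number of indices [j] such that [x] lies in [V j]. *)
Definition mult (V : J -> set M) (x : M) : nat := #|[pred j | `[< V j x >]]|.

(** Every open cover of [C] indexed by [J] can be shrunk to an open cover of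
    [C] with the same indices, of multiplicity at most [k] at the points of
    [F].  Keeping the indices makes the finite sum theorem immediate. *)
Definition shrinkable (C F : set M) (k : nat) : Prop :=
  forall U : J -> set M, (forall j, open (U j)) ->
    (forall x, C x -> exists j, U j x) ->
  exists V : J -> set M, [/\ forall j, open (V j), forall j, V j `<=` U j,
    forall x, C x -> exists j, V j x & forall x, F x -> (mult V x <= k)%N].

Lemma mult_le (V W : J -> set M) x y :
  (forall j, V j x -> W j y) -> (mult V x <= mult W y)%N.
Proof.
by move=> VW; apply/subset_leq_card/fintype.subsetP => j /asboolP Vj; apply/asboolP; exact: VW.
Qed.

(** Finite sum theorem: shrink the cover for one set after the other; a
    further shrinking does not increase multiplicities. *)
Lemma shrinkable_bigU (C : set M) k (I : eqType) (s : seq I) (F : I -> set M) :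
  (forall i, i \in s -> shrinkable C (F i) k) ->
  shrinkable C [set x | exists2 i, i \in s & F i x] k.
Proof.
elim: s => [|i s IH] H U oU CU.
  by exists U; split=> // [j z //|x [i]//].
have [|V [oV VU CV mV]] := IH _ U oU CU.
  by move=> j js; apply: H; rewrite inE js orbT.
have [|W [oW WV CW mW]] := H i _ V oV CV; first by rewrite inE eqxx.
exists W; split=> // [j|x [j]]; first exact: subset_trans (WV j) (VU j).
rewrite inE => /predU1P[->|js] Fx; first exact: mW.
by apply: leq_trans (mV x _); [apply: mult_le => l; exact: WV | exists j].
Qed.

(** A multiplicity bound on [F] can be propagated to the whole space without
    losing the trace of the sets on [F].  A point [z] of the new set [O j] is
    close to a point [y j] of [F] deep inside [W j]; the [y j] of smallest
    radius then lies in all the sets [W i] such that [z] lies in [O i]. *)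
Lemma swelling (F : set M) (W : J -> set M) k :
  (forall j, open (W j)) -> (forall x, F x -> (mult W x <= k)%N) ->
  exists O : J -> set M, [/\ forall j, open (O j), forall j, O j `<=` W j,
    forall j x, F x -> W j x -> O j x & forall x, (mult O x <= k)%N].
Proof.
move=> oW mW.
pose O j : set M := [set z | exists y : M, exists e : R,
   [/\ F y, 0 < e, ball y (2 * e) `<=` W j & ball y e z]].
exists O; split.
- move=> j; rewrite openE => z [y [e [Fy e0 yW yz]]].
  have /nbhs_ballP[d d0 dP] : nbhs z (ball y e).
    by apply: open_nbhs_nbhs; split=> //; exact: ball_open.
  by apply/nbhs_ballP; exists d => // t /dP yt; exists y, e.
- move=> j z [y [e [Fy e0 yW yz]]]; apply: yW; apply: le_ball yz; lra.
- move=> j x Fx Wx; have /nbhs_ballP[d /= d0 dW] : nbhs x (W j).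
    exact: open_nbhs_nbhs.
  exists x, (d / 2); split=> //; rewrite ?divr_gt0 //; last exact: ballxx (divr_gt0 _ _).
  by rewrite mulrC divfK ?pnatr_eq0.
- move=> z.
  have [no|] := pselect (forall j, ~ O j z).
    by rewrite /mult eq_card0 // => j; rewrite !inE; apply/asboolP.
  move=> /existsNP[j0 /contrapT Oj0].
  have [y0 [e0 y0P]] := Oj0.
  have /choice[f fP] : forall j, exists p : M * R, O j z ->
      [/\ F p.1, 0 < p.2, ball p.1 (2 * p.2) `<=` W j & ball p.1 p.2 z].
    move=> j; have [[y [e H]]|no] := pselect (O j z); first by exists (y, e).
    by exists (y0, e0).
  have PO0 : `[< O j0 z >] by apply/asboolP.
  case: (@arg_minP _ _ _ j0 (fun j => `[< O j z >]) (fun j => (f j).2) PO0).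
  move=> j /asboolP Oj jmin.
  have [Fj ej _ zj] := fP j Oj.
  apply: leq_trans (mW _ Fj); apply: mult_le => i Oi.
  have [Fi ei Wi zi] := fP i Oi.
  have eij : (f j).2 <= (f i).2 by apply: jmin; apply/asboolP.
  apply: Wi; have := ball_triangle zi (ball_sym zj); apply: le_ball; lra.
Qed.

(** [sind_lt k F]: the subset [F] has small inductive dimension less than
    [k], in terms of open sets of the ambient space.  The partition is the part
    of [F] outside [U] and [V]. *)
Fixpoint sind_lt (k : nat) (F : set M) : Prop :=
  match k with
  | 0 => F = set0
  | k'.+1 => forall (x : M) (G : set M), F x -> open G -> G x ->
      exists U V : set M, [/\ open U, open V, U x, F `\` G `<=` V &
        F `&` (U `&` V) = set0 /\ sind_lt k' (F `\` (U `|` V))]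
  end.

(** Aleksandrov's inequality between the covering and the small inductive
    dimensions.  Finitely many small open sets [A x] cover [F]; the
    partitions [Fx x] between their centres and the outside are treated by
    induction and the sum theorem, and the rest of [F] is covered by the sets
    [P x], which are disjoint on [F]. *)
Lemma sind_shrinkable (C : set M) : compact C -> forall k F,
  closed F -> F `<=` C -> sind_lt k F -> shrinkable C F k.
Proof.
move=> cC; elim=> [|k IH] F clF FC /= indF U oU CU.
  exists U; split=> // [j z //|x]; by rewrite indF.
have /choice[f fP] : forall x : F, exists p : (set M * set M) * J,
   [/\ open p.1.1, open p.1.2, p.1.1 (set_val x), F `\` U p.2 `<=` p.1.2 &
     F `&` (p.1.1 `&` p.1.2) = set0 /\ sind_lt k (F `\` (p.1.1 `|` p.1.2))].
  move=> x; have Fx : F (set_val x) by apply: set_mem; exact: (valP x).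
  have [j Uj] := CU _ (FC _ Fx).
  have [A [B [oA oB Ax FB [AB0 sAB]]]] := indF _ (U j) Fx (oU j) Uj.
  by exists (A, B, j).
pose A x := (f x).1.1; pose B x := (f x).1.2; pose Fx x := F `\` (A x `|` B x).
have oA x : open (A x) by have [] := fP x.
have oB x : open (B x) by have [] := fP x.
have AU x z : F z -> A x z -> U (f x).2 z.
  move=> Fz Az; apply: contrapT => nU; have [_ _ _ FB [e _]] := fP x.
  have : (F `&` (A x `&` B x)) z by split=> //; split=> //; exact: FB.
  by rewrite /A /B e.
have cF : compact F by exact: subclosed_compact clF cC FC.
have [s sP] : exists s : seq F, forall z, F z -> exists2 x, x \in s & A x z.
  apply: compact_fin_subcover cF oA _ => z Fz.
  by exists (exist _ z (mem_set Fz)); have [] := fP (exist _ z (mem_set Fz)).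
have shF : shrinkable C [set z | exists2 x, x \in s & Fx x z] k.
  apply: shrinkable_bigU => x _; have [_ _ _ _ [_ sx]] := fP x; apply: IH => //.
    by apply: closedI => //; apply: open_closedC; apply: openU.
  by move=> z [/FC].
have [W [oW WU CW mW]] := shF U oU CU.
have [Q [oQ QW FQ mQ]] := swelling oW mW.
(* the P x are disjoint on F, because A y and B y are for every y *)
pose P x : set M :=
  A x `&` [set z | forall y, y \in take (index x s) s -> B y z].
have Popen x : open (P x).
  by apply: openI => //; apply: open_allin => y _.
exists (fun j => Q j `|` ((U j `\` F) `|`
   [set z | U j z /\ exists x, [/\ x \in s, (f x).2 = j & P x z]])).
split.
- move=> j; apply: openU; first exact: oQ.
  apply: openU; first by apply: openI => //; exact: closed_openC.
  rewrite (_ : [set z | _] = U j `&`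
     \bigcup_(x in [set x | x \in s /\ (f x).2 = j]) P x).
    by apply: openI => //; apply: bigcup_open => x _.
  rewrite predeqE => z; split=> [[Uz [x [xs fx Px]]]|[Uz [x [xs fx] Px]]];
    by split=> //; exists x.
- by move=> j z [/QW/WU//|[[]//|[]]].
- move=> z Cz; have [Fz|nFz] := pselect (F z); last first.
    by have [j Uj] := CU z Cz; exists j; right; left.
  have [bd|nbd] := pselect (exists2 x, x \in s & Fx x z).
    by have [j Wj] := CW z Cz; exists j; left; apply: FQ.
  have hs : has (fun x => `[< A x z >]) s.
    by have [x xs Ax] := sP z Fz; apply/hasP; exists x => //; apply/asboolP.
  have [x0 x0s Ax0] := sP z Fz.
  pose i := find (fun x => `[< A x z >]) s.
  have ilt : (i < size s)%N by rewrite -has_find.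
  pose x := nth x0 s i.
  have Ax : A x z by apply/asboolP; exact: nth_find hs.
  have xs : x \in s by exact: mem_nth.
  exists (f x).2; right; right; split; first exact: AU.
  exists x; split=> //; split=> // y yt.
  have ys := mem_take yt.
  have yi : (index y s < i)%N.
    have : (index y s < index x s)%N by rewrite index_ltn.
    move/leq_trans; apply.
    by rewrite leqNgt; apply/negP => /(before_find x0); rewrite /= eqxx.
  have nAy : ~ A y z.
    by move: yi => /(before_find x0); rewrite nth_index // => /asboolP.
  by apply: contrapT => nBy; apply: nbd; exists y => //; split=> // -[].
- move=> z Fz.
  have [[x [xs Px]]|noP] := pselect (exists x, x \in s /\ P x z).
    apply: (@leq_trans (mult Q z + #|pred1 (f x).2|)); last first.
      by rewrite card1 addn1 ltnS.
    rewrite /mult -cardUI; apply: leq_trans (leq_addr _ _).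
    apply/subset_leq_card/fintype.subsetP => j /asboolP Vj; rewrite inE; move: Vj.
    case=> [Qj|[[_ /(_ Fz)//]|[_ [y [ys <- Py]]]]].
      by apply/orP; left; apply/(asboolP (Q j z)).
    apply/orP; right; apply/eqP; congr (f _).2.
    have key u v : u \in s -> v \in s -> P u z -> P v z -> ~ (index u s < index v s)%N.
      move=> us vs [Au _] [_ Bv] uv; have [_ _ _ _ [e _]] := fP u.
      have : (F `&` (A u `&` B u)) z.
        by split=> //; split=> //; apply: Bv; rewrite in_take_leq // ltnW // index_mem.
      by rewrite /A /B e.
    have := key x y xs ys Px Py; have := key y x ys xs Py Px.
    move=> /negP + /negP; rewrite -!leqNgt => h1 h2.
    have e : index x s = index y s by apply/eqP; rewrite eqn_leq h1 h2.
    by rewrite -[y](nth_index x ys) -e nth_index.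
  apply: leq_trans (leqnSn _); apply: leq_trans (mQ z).
  apply: mult_le => j [//|[[_ /(_ Fz)//]|[_ [x [xs _ Px]]]]].
  by case: noP; exists x.
Qed.
End Shrink.

(** * The covering dimension of the cube *)

(** The unit cube, as a set of row vectors with the maximum norm. *)
Definition cube (R : realType) (n : nat) : set 'rV[R]_n :=
  [set q | forall i, 0 <= q ord0 i <= 1].
Arguments cube : clear implicits.

Lemma cube_compact (R : realType) n : compact (cube R n).
Proof.
have -> : cube R n = [set v | forall i, (`[0, 1]%classic : set R) (v ord0 i)].
  by rewrite predeqE => v; split=> H i; have := H i; rewrite /= in_itv.
have := @rV_compact R n (fun=> `[0, 1]%classic) (fun=> @segment_compact R 0 1). exact.
Qed.

Lemma lebesgue_number (R : realType) (M : normedModType R) (J : Type)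
    (C : set M) (V : J -> set M) :
  compact C -> (forall j, open (V j)) -> (forall x, C x -> exists j, V j x) ->
  exists2 lam : R, 0 < lam & forall x, C x -> exists j, ball x lam `<=` V j.
Proof.
move=> /compact_near_coveringP cC oV CV.
have := cC _ (0 : R)^'+ (fun r x => exists j, ball x r `<=` V j) _.
case=> [x Cx|r /= r0 rP].
  have [j Vj] := CV x Cx.
  have /nbhs_ballP[r /= r0 rV] : nbhs x (V j) by exact: open_nbhs_nbhs.
  exists (ball x (r / 2), [set t | t < r / 2]) => /=.
    split; first by apply: nbhsx_ballx; rewrite divr_gt0.
    by apply: nbhs_right_lt; rewrite divr_gt0.
  move=> [y t] /= [xy tr]; exists j => z yz; apply: rV.
  by have := ball_triangle xy yz; apply: le_ball; lra.
have r2 : 0 < r / 2 by rewrite divr_gt0.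
exists (r / 2) => // x Cx; apply: (rP (r / 2)) => //=.
by rewrite /ball /= sub0r normrN gtr0_norm //; lra.
Qed.

Section Covering.
Variables (R : realType) (n : nat).
Local Notation M := 'rV[R]_n.

(** Lebesgue's covering theorem.  The open sets [Z j] encode Kuhn's boundary
    condition; a fine grid is labelled by indices [j] such that a ball of
    radius the Lebesgue number is contained in [V j], so that any vertex of a
    cube carrying all the labels lies in all the [V j]. *)
Lemma cube_not_shrinkable : ~ shrinkable 'I_n.+1 (cube R n) (cube R n) n.
Proof.
pose Z (j : 'I_n.+1) : set M :=
  [set x | forall i : 'I_n, i \in enum 'I_n ->
     (if i.+1 == j then [set x : M | 0 < x ord0 i] else
      if (j <= i)%N then [set x : M | x ord0 i < 1] else setT) x].
have oZ j : open (Z j).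
  apply: open_allin => i _; case: eqP => _.
    apply: (@open_comp _ _ (fun x : M => x ord0 i) [set t | 0 < t]) => [x _|].
      exact: coord_continuous.
    exact: open_gt.
  case: ifP => _; last exact: openT.
  apply: (@open_comp _ _ (fun x : M => x ord0 i) [set t | t < 1]) => [x _|].
    exact: coord_continuous.
  exact: open_lt.
have CZ x : cube R n x -> exists j, Z j x.
  move=> Cx.
  have [[i0 i01]|no] := pselect (exists i, x ord0 i = 1); last first.
    exists ord0 => i _ /=; rewrite lt_neqAle (andP (Cx i)).2 andbT.
    by apply/eqP => e; apply: no; exists i.
  have P0 : x ord0 i0 == 1 by apply/eqP.
  case: (@arg_maxP _ _ _ i0 (fun i => x ord0 i == 1) (fun i => i : nat) P0).
  move=> i /eqP xi imax.
  have iN : (i.+1 < n.+1)%N by rewrite ltnS.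
  exists (Ordinal iN) => k _ /=; case: eqP => [[/val_inj->]|_].
    by rewrite /= xi.
  case: ifP => //= ik; rewrite lt_neqAle (andP (Cx k)).2 andbT.
  by apply/negP => /imax /=; rewrite leEnat; lia.
move=> /(_ Z oZ CZ)[V [oV VZ CV mV]].
have [lam lam0 lamP] := lebesgue_number (@cube_compact R n) oV CV.
have [N N0 Nlam] : exists2 N : nat, (0 < N)%N & N%:R^-1 < lam.
  exists (Num.truncn lam^-1).+1 => //.
  rewrite invf_plt ?posrE ?ltr0n //; exact: truncnS_gt.
have N0R : 0 < (N%:R : R) by rewrite ltr0n.
pose g (v : 'I_n -> nat) : M := \row_i ((v i)%:R / N%:R).
have gC v : (forall i, (v i <= N)%N) -> cube R n (g v).
  move=> vN i; rewrite mxE divr_ge0 ?ler0n //=.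
  by rewrite ler_pdivrMr // mul1r ler_nat.
have /choice[l lP] : forall v : 'I_n -> nat, exists j : 'I_n.+1,
    (forall i, (v i <= N)%N) -> ball (g v) lam `<=` V j.
  move=> v; have [vN|vN] := pselect (forall i, (v i <= N)%N); last by exists ord0.
  by have [j jP] := lamP _ (gC v vN); exists j.
have lk : kuhn_labelling N (fun v => l v : nat).
  move=> v vN; have Zv : Z (l v) (g v).
    by apply: VZ; apply: lP => //; exact: ballxx.
  split=> [|i vi e|i vi].
  - by rewrite -ltnS.
  - have := Zv i (mem_enum _ _); rewrite -e eqxx /= mxE vi mul0r.
    by rewrite ltxx.
  - rewrite ltnNge; apply/negP => li; have := Zv i (mem_enum _ _).
    rewrite li; case: eqP => [e|_]; first lia.
    by rewrite /= mxE vi divff ?ltxx // gt_eqF.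
have [v [lv vN vv]] := kuhn N0 lk.
have := mV (g (v ord0)) (gC _ (vN ord0)); apply/negP; rewrite -ltnNge.
rewrite /mult eq_cardT ?size_enum_ord // => j.
apply/asboolP; have -> : j = l (v j) by apply: val_inj; rewrite /= lv.
apply: lP => //; split=> // a i; rewrite !mxE -ball_normE /= -mulrBl.
apply: le_lt_trans Nlam; rewrite normrM [`|_^-1|]gtr0_norm ?invr_gt0 //.
rewrite -[leRHS]mul1r ler_pM2r ?invr_gt0 //.
have := vv j ord0 i; have := vv ord0 j i.
rewrite -![(_ <= _.+1)%N](ler_nat R) -![_.+1%:R]natr1 ler_norml; lra.
Qed.
End Covering.

(** * The ring of bounded uniformly continuous functions *)

Lemma separating_hausdorff (R : realType) (T : topologicalType) :
  (forall p q : T, p <> q -> exists2 f : T -> R, continuous f & f p <> f q) ->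
  hausdorff_space T.
Proof.
move=> sep p q pq; apply: contrapT => /sep[f cf fpq]; apply: fpq.
apply: (@norm_hausdorff _ R) => A B Ap Bq.
have [z [Az Bz]] := pq _ _ (cf p A Ap) (cf q B Bq).
by exists (f z).
Qed.

Lemma compact_set_type (T : topologicalType) (A : set T) :
  compact A -> compact [set: A].
Proof.
move=> cA F FF _; pose G : set_system T := fmap set_val F.
have [|p [Ap clp]] := cA G _.
  by rewrite /G /fmap /=; apply: filterS filterT => x _; apply: set_mem; exact: (valP x).
exists (exist _ p (mem_set Ap)); split=> // B N FB [W [[V oV <-] /= Vp sN]].
have GB : G (set_val @` B).
  by rewrite /G /fmap /=; apply: filterS FB => x Bx; exists x.
have Vn : nbhs p V by apply: open_nbhs_nbhs; split.
have [z [[x Bx <-] Vx]] := clp _ _ GB Vn.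
by exists x; split=> //; exact: sN.
Qed.

Lemma continuous_set_val (T : topologicalType) (A : set T) :
  continuous (set_val : A -> T).
Proof. exact: initial_continuous. Qed.

Section Ustar_ring.
Variables (R : realType) (X : topologicalType) (d : X -> X -> R).

Lemma UstarP (f : X -> R) : Ustar d f <->
  (exists M, forall x, `|f x| <= M) /\ dist_unif_continuous d f.
Proof.
split=> [[bf uf]|[[M fM] uf]]; split=> //.
  have /pinfty_ex_gt0[M _ fM] := bf.
  by exists M => x; apply: fM.
exists M; split; first exact: num_real.
by move=> y My x _; apply: le_trans (fM x) (ltW My).
Qed.

Lemma Ustar_cst (c : R) : Ustar d (fun=> c).
Proof.
apply/UstarP; split; first by exists `|c|.
by move=> e e0; exists 1 => // x y _; rewrite subrr normr0.
Qed.

Lemma Ustar_add f g : Ustar d f -> Ustar d g -> Ustar d (fun x => f x + g x).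
Proof.
move=> /UstarP[[M fM] uf] /UstarP[[N gN] ug]; apply/UstarP; split.
  by exists (M + N) => x; rewrite (le_trans (ler_normD _ _)) // lerD.
move=> e e0; have e2 : 0 < e / 2 by rewrite divr_gt0.
have [a a0 fa] := uf _ e2; have [b b0 gb] := ug _ e2.
exists (Num.min a b); first by rewrite lt_min a0.
move=> x y; rewrite lt_min => /andP[/fa h1 /gb h2].
rewrite (_ : _ - _ = (f x - f y) + (g x - g y)); last by ring.
by rewrite (le_lt_trans (ler_normD _ _)) //; lra.
Qed.

Lemma Ustar_mul f g : Ustar d f -> Ustar d g -> Ustar d (fun x => f x * g x).
Proof.
move=> /UstarP[[M0 fM0] uf] /UstarP[[N0 gN0] ug]; apply/UstarP.
pose M := `|M0| + 1; pose N := `|N0| + 1.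
have M1 : 0 < M by rewrite ltr_wpDl.
have N1 : 0 < N by rewrite ltr_wpDl.
have fM x : `|f x| <= M by have := fM0 x; have := ler_norm M0; rewrite /M; lra.
have gN x : `|g x| <= N by have := gN0 x; have := ler_norm N0; rewrite /N; lra.
split; first by exists (M * N) => x; rewrite normrM ler_pM.
move=> e e0.
have eN : 0 < e / 2 / N by rewrite !divr_gt0.
have eM : 0 < e / 2 / M by rewrite !divr_gt0.
have [a a0 fa] := uf _ eN; have [b b0 gb] := ug _ eM.
exists (Num.min a b); first by rewrite lt_min a0.
move=> x y; rewrite lt_min => /andP[/fa h1 /gb h2].
rewrite (_ : _ - _ = (f x - f y) * g x + f y * (g x - g y)); last by ring.
rewrite (le_lt_trans (ler_normD _ _)) // !normrM (splitr e).
apply: ltr_leD.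
  move: h1; rewrite ltr_pdivlMr //; apply: le_lt_trans.
  by rewrite ler_wpM2l.
rewrite mulrC; move: h2; rewrite ltr_pdivlMr // => /ltW; apply: le_trans.
by rewrite ler_wpM2l.
Qed.

Lemma Ustar_sum (I : Type) (s : seq I) (f : I -> X -> R) :
  (forall i, Ustar d (f i)) -> Ustar d (fun x => \sum_(i <- s) f i x).
Proof.
move=> Uf; elim: s => [|i s IH].
  by under eq_fun do rewrite big_nil; exact: Ustar_cst.
by under eq_fun do rewrite big_cons; exact: Ustar_add.
Qed.

Lemma Ustar_prod (I : Type) (s : seq I) (f : I -> X -> R) :
  (forall i, Ustar d (f i)) -> Ustar d (fun x => \prod_(i <- s) f i x).
Proof.
move=> Uf; elim: s => [|i s IH].
  by under eq_fun do rewrite big_nil; exact: Ustar_cst.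
by under eq_fun do rewrite big_cons; exact: Ustar_mul.
Qed.

Lemma Ustar_lip (f : X -> R) (M L : R) : (forall x y, 0 <= d x y) ->
  (forall x, `|f x| <= M) ->
  (forall x y, `|f x - f y| <= L * d x y) -> Ustar d f.
Proof.
move=> d0 fM fL; apply/UstarP; split; first by exists M.
move=> e e0; have L0 : 0 < `|L| + 1 by rewrite ltr_wpDl.
exists (e / (`|L| + 1)); first by rewrite divr_gt0.
move=> x y; rewrite ltr_pdivlMr // => h; apply: le_lt_trans (fL x y) _.
apply: le_lt_trans h; rewrite mulrC ler_wpM2l //.
by have := ler_norm L; lra.
Qed.
End Ustar_ring.

(** * The remainder of the Smirnov compactification *)

Lemma continuous_to_ptws (Z : topologicalType) (I : Type) (V : topologicalType)
    (g : Z -> {ptws I -> V}) :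
  (forall i, continuous (fun z => g z i)) -> continuous g.
Proof.
move=> cg z; apply/cvg_sup => i; move: z.
apply/(@continuousP _ (initial_topology (@^~ i))) => A [B oB <-].
rewrite -comp_preimage.
by move/continuousP: (cg i); apply.
Qed.

(** Throughout, [r] is a positive function vanishing at infinity. *)
Section Remainder.
Variables (R : realType) (X : topologicalType) (d : X -> X -> R) (r : X -> R).
Hypothesis Ur : Ustar d r.
Hypothesis r_gt0 : forall x, 0 < r x.
Hypothesis r_cpt : forall c, 0 < c -> compact [set x | c <= r x].
Hypothesis Ucont : forall f, Ustar d f -> continuous f.
Local Notation P := {ptws Ustar d -> R}.
Local Notation Y := (smirnov_remainder d).

(** The value at [p] of the extension of [f] to the compactification, that
    is the coordinate of [p] with index [f]; by convention 0 when [f] does not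
    belong to [Ustar d]. *)
Definition hat (f : X -> R) (p : P) : R :=
  if pselect (Ustar d f) is left h then p (exist _ f (mem_set h)) else 0.

Lemma hatE (f : Ustar d) (p : P) : hat (set_val f) p = p f.
Proof.
rewrite /hat; case: pselect => [h|nh]; last first.
  by case: nh; apply: set_mem; exact: (valP f).
by congr p; apply: val_inj.
Qed.

Lemma hat_eval f x : Ustar d f -> hat f (smirnov_eval d x) = f x.
Proof. by rewrite /hat; case: pselect. Qed.

Lemma hat_continuous f : continuous (hat f).
Proof.
rewrite /hat; case: pselect => [h|_]; last exact: cst_continuous.
exact: (@proj_continuous _ (fun _ : Ustar d => R)).
Qed.

Lemma hat_ext (p q : P) : (forall f, Ustar d f -> hat f p = hat f q) -> p = q.
Proof.
move=> pq; apply: funext => f; rewrite -!hatE; apply: pq.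
by apply: set_mem; exact: (valP f).
Qed.

Lemma ptws_hausdorff : hausdorff_space P.
Proof.
apply: (@separating_hausdorff R) => p q pq.
have /existsNP[f] : ~ forall f, hat f p = hat f q.
  by move=> H; apply: pq; apply: hat_ext => f _.
by exists (hat f) => //; exact: hat_continuous.
Qed.

Lemma smirnov_cube_compact : compact (smirnov_cube d).
Proof.
have := @tychonoff (Ustar d) (fun=> R) (fun f => `[inf (range (set_val f)),
  sup (range (set_val f))]%classic) (fun f => @segment_compact R _ _).
congr compact; rewrite predeqE => p; split=> H f; have := H f;
  by rewrite /= in_itv.
Qed.

Lemma smirnov_eval_cube x : smirnov_cube d (smirnov_eval d x).
Proof.
move=> f; have /UstarP[[M fM] _] : Ustar d (set_val f).
  by apply: set_mem; exact: (valP f).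
apply/andP; split.
  apply: ge_inf; last by exists x.
  by exists (- M) => _ [y _ <-]; have := fM y; rewrite ler_norml => /andP[].
apply: ub_le_sup; last by exists x.
by exists M => _ [y _ <-]; have := fM y; rewrite ler_norml => /andP[].
Qed.

Lemma smirnov_closure : smirnov d = closure (range (smirnov_eval d)).
Proof.
rewrite /smirnov predeqE => p; split=> [[]//|cp]; split=> //.
have cl : closed (smirnov_cube d) by apply: compact_closed ptws_hausdorff smirnov_cube_compact.
rewrite ((closure_id _).1 cl); move: cp; apply: closureS.
by move=> _ [x _ <-]; exact: smirnov_eval_cube.
Qed.

Lemma smirnov_eval_continuous : continuous (smirnov_eval d).
Proof.
apply: continuous_to_ptws => f; apply: Ucont.
by apply: set_mem; exact: (valP f).
Qed.

(** The remainder is the zero set of the extension of [r]: a point where it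
    is positive is in the closure of the image of a compact set, hence in that
    image. *)
Lemma remainderE : Y = smirnov d `&` [set p | hat r p = 0].
Proof.
rewrite predeqE => p; split=> [[sp np]|[sp rp]]; split=> //; last first.
  by move=> [x _ xp]; move: rp; rewrite /= -xp hat_eval // => rx0; have := r_gt0 x;
    rewrite rx0 ltxx.
apply: contrapT => rp0; apply: np; rewrite smirnov_closure in sp.
pose c := `|hat r p| / 2.
have c0 : 0 < c by rewrite divr_gt0 // normr_gt0; apply/eqP.
have : closed (smirnov_eval d @` [set x | c <= r x]).
  apply: compact_closed ptws_hausdorff _; apply: continuous_compact; last exact: r_cpt.
  by apply: continuous_subspaceT; exact: smirnov_eval_continuous.
move=> cl; suff : (smirnov_eval d @` [set x | c <= r x]) p by case=> x _ <-; exists x.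
apply: cl => B Bp.
have oU : nbhs p [set q | c < `|hat r q|].
  apply: open_nbhs_nbhs; split; last first.
    by rewrite /= /c ltr_pdivrMr // mulr_natr mulr2n ltrDl normr_gt0; apply/eqP.
  apply: (@open_comp _ _ (fun q => `|hat r q|) [set t | c < t]); last exact: open_gt.
  move=> q _; apply: continuous_comp; last exact: norm_continuous.
  exact: hat_continuous.
have [_ [[x _ <-] [Bx cx]]] := sp _ (filterI Bp oU).
exists (smirnov_eval d x); split=> //; exists x => //=.
by move: cx; rewrite /= hat_eval // gtr0_norm // => /ltW.
Qed.

Lemma remainder_compact : compact Y.
Proof.
rewrite remainderE; apply: (@subclosed_compact _ _ (smirnov_cube d)).
- apply: closedI.
    by rewrite smirnov_closure; exact: closed_closure.
  apply: (@closed_comp _ _ (hat r) [set t | t = 0]); last exact: closed_eq.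
  by move=> q _; exact: hat_continuous.
- exact: smirnov_cube_compact.
- by move=> p [[]].
Qed.

(** A closed condition satisfied near infinity in [X] holds on the
    remainder. *)
Lemma transfer (eta : R) (A : set P) : 0 < eta -> closed A ->
  (forall x, r x < eta -> A (smirnov_eval d x)) -> Y `<=` A.
Proof.
move=> eta0 cA H p; rewrite remainderE smirnov_closure => -[cp rp].
apply: cA => B Bp.
have oU : nbhs p [set q | hat r q < eta].
  apply: open_nbhs_nbhs; split; last by rewrite /= rp.
  apply: (@open_comp _ _ (hat r) [set t | t < eta]); last exact: open_lt.
  by move=> q _; exact: hat_continuous.
have [_ [[x _ <-] [Bx cx]]] := cp _ (filterI Bp oU).
exists (smirnov_eval d x); split=> //; apply: H.
by move: cx; rewrite /= hat_eval.
Qed.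

Lemma transfer_ge0 (eta : R) (h : P -> R) : 0 < eta -> continuous h ->
  (forall x, r x < eta -> 0 <= h (smirnov_eval d x)) -> forall p, Y p -> 0 <= h p.
Proof.
move=> eta0 ch H; apply: (transfer eta0 _ H).
apply: (@closed_comp _ _ h [set t | 0 <= t]); last exact: closed_ge.
by move=> q _; exact: ch.
Qed.

Lemma transfer_eq0 (eta : R) (h : P -> R) : 0 < eta -> continuous h ->
  (forall x, r x < eta -> h (smirnov_eval d x) = 0) -> forall p, Y p -> h p = 0.
Proof.
move=> eta0 ch H; apply: (transfer eta0 _ H).
apply: (@closed_comp _ _ h [set t | t = 0]); last exact: closed_eq.
by move=> q _; exact: ch.
Qed.

Lemma hat_ge0 (eta : R) f : 0 < eta -> Ustar d f ->
  (forall x, r x < eta -> 0 <= f x) -> forall p, Y p -> 0 <= hat f p.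
Proof.
move=> eta0 Uf H; apply: (transfer_ge0 eta0 (hat_continuous (f := f))) => x rx.
by rewrite hat_eval //; exact: H.
Qed.

Lemma hat_cst (c : R) p : Y p -> hat (fun=> c) p = c.
Proof.
move=> Yp; apply/eqP; rewrite -subr_eq0; apply/eqP.
apply: (transfer_eq0 (h := fun p => hat (fun=> c) p - c) ltr01 _ _ Yp) => [q|x _].
  by apply: continuousB; [exact: hat_continuous|exact: cst_continuous].
by rewrite hat_eval ?subrr //; exact: Ustar_cst.
Qed.

Lemma hat_add f g p : Ustar d f -> Ustar d g -> Y p ->
  hat (fun x => f x + g x) p = hat f p + hat g p.
Proof.
move=> Uf Ug Yp; apply/eqP; rewrite -subr_eq0; apply/eqP.
apply: (transfer_eq0 (h := fun p => hat (fun x => f x + g x) p - (hat f p + hat g p))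
   ltr01 _ _ Yp) => [q|x _].
  apply: continuousB; first exact: hat_continuous.
  by apply: continuousD; exact: hat_continuous.
by rewrite !hat_eval ?subrr //; exact: Ustar_add.
Qed.

Lemma hat_mul f g p : Ustar d f -> Ustar d g -> Y p ->
  hat (fun x => f x * g x) p = hat f p * hat g p.
Proof.
move=> Uf Ug Yp; apply/eqP; rewrite -subr_eq0; apply/eqP.
apply: (transfer_eq0 (h := fun p => hat (fun x => f x * g x) p - (hat f p * hat g p))
   ltr01 _ _ Yp) => [q|x _].
  apply: continuousB; first exact: hat_continuous.
  by apply: continuousM; exact: hat_continuous.
by rewrite !hat_eval ?subrr //; exact: Ustar_mul.
Qed.

Lemma hat_sum (I : Type) (s : seq I) (f : I -> X -> R) p :
  (forall i, Ustar d (f i)) -> Y p ->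
  hat (fun x => \sum_(i <- s) f i x) p = \sum_(i <- s) hat (f i) p.
Proof.
move=> Uf Yp; elim: s => [|i s IH].
  by under eq_fun do rewrite big_nil; rewrite big_nil hat_cst.
under eq_fun do rewrite big_cons; rewrite big_cons -IH hat_add //.
exact: Ustar_sum.
Qed.

Lemma hat_prod (I : Type) (s : seq I) (f : I -> X -> R) p :
  (forall i, Ustar d (f i)) -> Y p ->
  hat (fun x => \prod_(i <- s) f i x) p = \prod_(i <- s) hat (f i) p.
Proof.
move=> Uf Yp; elim: s => [|i s IH].
  by under eq_fun do rewrite big_nil; rewrite big_nil hat_cst.
under eq_fun do rewrite big_cons; rewrite big_cons -IH hat_mul //.
exact: Ustar_prod.
Qed.

Lemma remainder_hausdorff : hausdorff_space Y.
Proof.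
apply: (@separating_hausdorff R) => p q pq.
have /existsNP[f fpq] : ~ forall f, hat f (set_val p) = hat f (set_val q).
  by move=> H; apply: pq; apply: val_inj; apply: hat_ext => f _.
exists (hat f \o set_val) => //= z.
by apply: continuous_comp; [exact: continuous_set_val|exact: hat_continuous].
Qed.

(** The extension of [f], as a function on the space [smirnov_remainder d]. *)
Definition yhat (f : X -> R) (p : Y) : R := hat f (set_val p).

Lemma yhat_continuous f : continuous (yhat f).
Proof.
by move=> z; apply: continuous_comp; [exact: continuous_set_val|exact: hat_continuous].
Qed.

Lemma remainder_mem (p : Y) : Y (set_val p).
Proof. by apply: set_mem; exact: (valP p). Qed.

(** The extensions of functions of [Ustar d] separate a point from a closed
    set of the remainder: two points are distinguished by the square of an
    affine function of some [f], and finitely many such squares are summed by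
    compactness. *)
Lemma separate_open (U : set Y) (p : Y) : open U -> U p ->
  exists h : X -> R, [/\ Ustar d h, yhat h p = 2 &
    forall q, 0 < yhat h q -> U q].
Proof.
move=> oU Up.
have /choice[g gP] (q : ~` U) : exists g : X -> R, [/\ Ustar d g,
    yhat g p = 0, 2 < yhat g (set_val q) & forall y, 0 <= yhat g y].
  have nUq : ~ U (set_val q) by apply: set_mem; exact: (valP q).
  have /existsNP[f] : ~ forall f, yhat f p = yhat f (set_val q).
    move=> H; apply: nUq; rewrite (_ : set_val q = p) //.
    by apply: val_inj; apply: hat_ext => f _; rewrite [RHS]H.
  have [Uf fpq|nUf] := pselect (Ustar d f); last first.
    by case; rewrite /yhat /hat; case: pselect.
  pose a := yhat f p; pose b := yhat f (set_val q).
  have ab : b - a != 0 by rewrite subr_eq0; apply/eqP => e; apply: fpq.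
  pose l x := 2 * (b - a)^-1 * (f x + - a).
  have Uc c : Ustar d (fun=> c) by exact: Ustar_cst.
  have Ul : Ustar d l by apply: Ustar_mul; [exact: Uc | exact: Ustar_add].
  have hl y : yhat (fun x => l x * l x) y = (2 * (b - a)^-1 * (yhat f y - a)) ^+ 2.
    rewrite /yhat hat_mul //; last exact: remainder_mem.
    have -> : hat l (set_val y) = 2 * (b - a)^-1 * (hat f (set_val y) - a).
      rewrite /l hat_mul //; [|exact: Ustar_add|exact: remainder_mem].
      by rewrite hat_add // ?hat_cst //; exact: remainder_mem.
    by rewrite expr2.
  exists (fun x => l x * l x); split.
  - exact: Ustar_mul.
  - by rewrite hl -/a subrr mulr0 expr0n.
  - by rewrite hl -/b -mulrA mulVf // mulr1; lra.
  - by move=> y; rewrite hl sqr_ge0.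
have cU : compact (~` U).
  apply: (@subclosed_compact _ _ setT) => //; first exact: open_closedC.
  exact: compact_set_type remainder_compact.
have [s sP] : exists s : seq (~` U), forall y, (~` U) y ->
    exists2 q, q \in s & [set y | 2 < yhat (g q) y] y.
  apply: compact_fin_subcover cU _ _ => [q|y nUy].
    apply: (@open_comp _ _ (yhat (g q)) [set t | 2 < t]); last exact: open_gt.
    by move=> z _; exact: yhat_continuous.
  by exists (exist _ y (mem_set nUy)); have [] := gP (exist _ y (mem_set nUy)).
have Ug q : Ustar d (g q) by have [] := gP q.
have Us : Ustar d (fun x => \sum_(q <- s) g q x) by exact: Ustar_sum.
have Un : Ustar d (fun x => -1 * \sum_(q <- s) g q x).
  by apply: Ustar_mul => //; exact: Ustar_cst.
have hE y : yhat (fun x => 2 + -1 * \sum_(q <- s) g q x) y =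
    2 - \sum_(q <- s) yhat (g q) y.
  have Yy := remainder_mem y.
  rewrite /yhat hat_add //; last exact: Ustar_cst.
  rewrite hat_mul // ?hat_cst ?hat_sum //; last exact: Ustar_cst.
  by rewrite mulN1r.
exists (fun x => 2 + -1 * \sum_(q <- s) g q x); split.
- by apply: Ustar_add => //; exact: Ustar_cst.
- by rewrite hE big1 ?subr0 // => q _; have [] := gP q.
- move=> y; rewrite hE subr_gt0 => lt2; apply: contrapT => /sP[q qs /= gq].
  have : yhat (g q) y <= \sum_(q <- s) yhat (g q) y.
    rewrite (perm_big _ (perm_to_rem qs)) big_cons lerDl.
    by apply: sumr_ge0 => q' _; have [] := gP q'.
  lra.
Qed.

End Remainder.

(** * Walls and cells in the remainder *)

Lemma cos_lipschitz (R : realType) (a b : R) : `|cos a - cos b| <= `|a - b|.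
Proof.
wlog ab : a b / b <= a => [H|].
  have [/H //|/ltW/H] := leP b a.
  by rewrite distrC (distrC b).
have [c _ ->] := @MVT_segment R cos (fun x => - sin x) b a ab
   (fun x _ => is_derive_cos x)
   (continuous_subspaceT (@continuous_cos R)).
by rewrite normrM normrN ler_piMl // sin_max.
Qed.

Lemma sin_pi_int (R : realType) (k : int) : sin (pi * k%:~R) = 0 :> R.
Proof.
have sn (n : nat) : sin (pi * n%:R) = 0 :> R.
  elim: n => [|n IH]; first by rewrite mulr0 sin0.
  by rewrite -natr1 mulrDr mulr1 sinDpi IH oppr0.
case: k => n; first exact: sn.
by rewrite NegzE mulrNz mulrN sinN -pmulrn sn oppr0.
Qed.

(** If [s] and [t] are separated by a half-integer, that is by a zero of
    $\cos(\pi x)$, then $\cos(\pi s)$ is small when [s] and [t] are close. *)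
Lemma cos_pi_label (R : realType) (s t : R) :
  Num.floor (s + 2^-1) != Num.floor (t + 2^-1) ->
  `|cos (pi * s)| <= pi * `|s - t|.
Proof.
move=> st.
have [k kst] : exists k : int, `|s - (k%:~R - 2^-1)| <= `|s - t|.
  have /andP[s1 s2] := floor_itv (s + 2^-1).
  have /andP[t1 t2] := floor_itv (t + 2^-1).
  have [lt|gt|e] := ltgtP (Num.floor (s + 2^-1)) (Num.floor (t + 2^-1)).
  - exists (Num.floor (t + 2^-1)).
    have : (Num.floor (s + 2^-1) + 1)%:~R <= ((Num.floor (t + 2^-1))%:~R : R).
      by rewrite ler_int lezD1.
    move=> h; rewrite !ler0_norm; lra.
  - exists (Num.floor (s + 2^-1)).
    have : (Num.floor (t + 2^-1) + 1)%:~R <= ((Num.floor (s + 2^-1))%:~R : R).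
      by rewrite ler_int lezD1.
    move=> h; rewrite !ger0_norm; lra.
  - by rewrite e eqxx in st.
have z0 : cos (pi * (k%:~R - 2^-1)) = 0 :> R.
  by rewrite mulrBr cosBpihalf sin_pi_int.
rewrite -[cos (pi * s)]subr0 -z0; apply: le_trans (cos_lipschitz _ _) _.
rewrite -mulrBr normrM (ger0_norm (pi_ge0 R)).
by rewrite ler_wpM2l // pi_ge0.
Qed.

(** The functions [T i] are uniformly continuous coordinates which determine
    the uniform structure of [X] near infinity. *)
Section Cells.
Variables (R : realType) (X : topologicalType) (d : X -> X -> R) (r : X -> R).
Variables (n : nat) (T : 'I_n -> X -> R).
Hypothesis Ur : Ustar d r.
Hypothesis r_gt0 : forall x, 0 < r x.
Hypothesis r_cpt : forall c, 0 < c -> compact [set x | c <= r x].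
Hypothesis Ucont : forall f, Ustar d f -> continuous f.
Hypothesis d_ge0 : forall x y, 0 <= d x y.
Hypothesis d_sym : forall x y, d x y = d y x.
Hypothesis T_lip : forall i x y, `|T i x - T i y| <= d x y.
Hypothesis d_small : forall e : R, 0 < e -> exists2 eta : R, 0 < eta &
  forall x y, r x < eta -> r y < eta -> (forall i, `|T i x - T i y| < eta) ->
    d x y < e.
Local Notation Y := (smirnov_remainder d).

(** This function vanishes exactly when the coordinate [T i] lies on the grid
    of odd multiples of $2^{-m-1}$. *)
Definition wave (m : nat) (i : 'I_n) (x : X) : R := cos (pi * (2 ^+ m * T i x)).

Lemma pi2_ge0 m : 0 <= pi * 2 ^+ m :> R.
Proof. by rewrite mulr_ge0 ?pi_ge0 ?exprn_ge0. Qed.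

Lemma wave_Ustar m i : Ustar d (wave m i).
Proof.
apply: (@Ustar_lip _ _ _ _ 1 (pi * 2 ^+ m)) => // [x|x y]; first exact: cos_max.
apply: le_trans (cos_lipschitz _ _) _.
rewrite -!mulrBr mulrA normrM (ger0_norm (pi2_ge0 m)).
by rewrite ler_wpM2l // pi2_ge0.
Qed.

(** The part of the remainder lying over the walls of the grid of mesh
    $2^{-m}$. *)
Definition walls (m : nat) : set Y := [set y | exists i, yhat (wave m i) y = 0].

Lemma wave_double m i (y : Y) :
  yhat (wave m.+1 i) y = 2 * (yhat (wave m i) y) ^+ 2 - 1.
Proof.
have Yy := remainder_mem y; have Uw := wave_Ustar m i.
have Uc c : Ustar d (fun=> c : R) by exact: Ustar_cst.
have -> : wave m.+1 i = fun x => 2 * (wave m i x * wave m i x) + -1.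
  apply: funext => x; rewrite /wave exprS -mulrA.
  rewrite (_ : pi * (2 * _) = (pi * (2 ^+ m * T i x)) *+ 2); last by rewrite mulr2n; ring.
  by rewrite cos_mulr2n; ring.
rewrite /yhat (hat_add Ur) //; last by do 2 apply: Ustar_mul => //.
rewrite (hat_mul Ur) //; last exact: Ustar_mul.
by rewrite (hat_mul Ur) // !(hat_cst Ur) // expr2.
Qed.

(** By the duplication formula, from a zero at level [m] the extension of
    [wave] takes the value -1 at the next level, and 1 at all the later ones. *)
Lemma walls_disjoint m m' i (y : Y) : (m < m')%N ->
  yhat (wave m i) y = 0 -> yhat (wave m' i) y != 0.
Proof.
move=> /subnK <- e0; set k := (m' - m.+1)%N.
suff : yhat (wave (k + m.+1) i) y ^+ 2 = 1.
  by move=> e; apply/eqP => e'; move: e; rewrite e' expr0n /= => /eqP;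
    rewrite eq_sym oner_eq0.
elim: k => [|k IH]; rewrite ?addSn wave_double.
  by rewrite e0 expr0n /= mulr0 sub0r sqrrN expr1n.
by rewrite IH; ring.
Qed.

(** A point on the walls of $n+1$ levels would be on two walls of different
    levels in the same coordinate. *)
Lemma walls_pigeonhole (ms : seq nat) (y : Y) : uniq ms -> (n < size ms)%N ->
  exists2 m, m \in ms & ~ walls m y.
Proof.
move=> ums lt; apply: contrapT => no.
have all_walls (l : 'I_(size ms)) : exists i, yhat (wave (nth 0%N ms l) i) y = 0.
  apply: contrapT => nw; apply: no; exists (nth 0%N ms l) => //.
  exact: mem_nth.
have [f fP] := choice all_walls.
have finj : injective f.
  move=> l l' e; apply/val_inj/eqP; rewrite -(nth_uniq 0%N (ltn_ord l) (ltn_ord l') ums).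
  have [lt'|lt'|//] := ltngtP (nth 0%N ms l) (nth 0%N ms l').
    by have := walls_disjoint lt' (fP l); rewrite e fP eqxx.
  by have := walls_disjoint lt' (fP l'); rewrite -e fP eqxx.
by have := leq_card f finj; rewrite !card_ord leqNgt lt.
Qed.

(** The cell of the grid of level [m] that contains [x]. *)
Definition cell_label (m : nat) (x : X) : 'I_n -> int :=
  fun i => Num.floor (2 ^+ m * T i x + 2^-1).

Lemma same_label m x y : cell_label m x = cell_label m y ->
  forall i, `|T i x - T i y| < (2 ^+ m)^-1.
Proof.
move=> /(congr1 (fun f => f _)) e i; have := e i; rewrite /cell_label => {}e.
have /andP[s1 s2] := floor_itv (2 ^+ m * T i x + 2^-1 : R).
have /andP[t1 t2] := floor_itv (2 ^+ m * T i y + 2^-1 : R).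
have p0 : 0 < 2 ^+ m :> R by rewrite exprn_gt0.
rewrite -[ltRHS]mul1r ltr_pdivlMr // -[X in _ * X](gtr0_norm p0) -normrM mulrBl.
rewrite e !intrD in s1 s2 t1 t2; rewrite ltr_norml ![_ * 2 ^+ m]mulrC; lra.
Qed.

(** A nonnegative function whose extension vanishes exactly on the walls. *)
Definition wave_prod m x : R := \prod_(i <- enum 'I_n) (wave m i x * wave m i x).

Lemma wave_prod_Ustar m : Ustar d (wave_prod m).
Proof. by apply: Ustar_prod => i; apply: Ustar_mul; exact: wave_Ustar. Qed.

Lemma wave_prod_ge0 m x : 0 <= wave_prod m x.
Proof. by apply: prodr_ge0 => i _; rewrite -expr2 sqr_ge0. Qed.

Lemma wave_prod_le m x i : wave_prod m x <= `|wave m i x|.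
Proof.
have w1 j : 0 <= wave m j x * wave m j x <= 1.
  by rewrite -expr2 sqr_ge0 -(real_normK (num_real _)) expr_le1 // cos_max.
rewrite /wave_prod big_enum /= (bigD1 i) //=.
apply: (@le_trans _ _ (wave m i x * wave m i x)).
  rewrite ler_piMr ?(andP (w1 i)).1 //.
  by apply: prodr_ile1 => j _.
by rewrite -expr2 -(real_normK (num_real _)) expr2 ler_piMr // cos_max.
Qed.

Lemma hat_wave_prod m (y : Y) : yhat (wave_prod m) y = \prod_(i <- enum 'I_n) yhat (wave m i) y ^+ 2.
Proof.
rewrite /yhat (hat_prod Ur) //; last exact: remainder_mem.
  apply: eq_bigr => i _; rewrite (hat_mul Ur) ?expr2 //; last exact: remainder_mem.
    exact: wave_Ustar.
  exact: wave_Ustar.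
by move=> i; apply: Ustar_mul; exact: wave_Ustar.
Qed.

Lemma hat_wave_prod_gt0 m (y : Y) : (0 < yhat (wave_prod m) y) <-> ~ walls m y.
Proof.
rewrite hat_wave_prod; split=> [+ [i e]|nw].
  by rewrite big_enum /= (bigD1 i) //= e expr0n mul0r ltxx.
apply: prodr_gt0 => i _; rewrite exprn_even_gt0 //=; apply/eqP => e.
by apply: nw; exists i.
Qed.

(** Finitely many functions of [Ustar d] have a common modulus of uniform
    continuity. *)
Lemma common_modulus (I : eqType) (s : seq I) (h : I -> X -> R) (e : R) : 0 < e ->
  (forall i, Ustar d (h i)) ->
  exists2 delta : R, 0 < delta & forall i x y, i \in s -> d x y < delta ->
    `|h i x - h i y| < e.
Proof.
move=> e0 Uh; elim: s => [|i s [a a0 IH]]; first by exists 1.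
have /UstarP[_ /(_ e e0)[b b0 hb]] := Uh i.
exists (Num.min a b); first by rewrite lt_min a0.
move=> j x y; rewrite inE lt_min => /predU1P[->|js] /andP[xa xb]; first exact: hb.
exact: IH.
Qed.

(** Outside the walls of a sufficiently fine grid, the remainder is the
    disjoint union of finitely many open sets subordinate to a given
    assignment [U] of open neighbourhoods.  Each set [V p] gathers the cells
    assigned to [p], through a uniformly continuous function [g p] supported by
    these cells. *)
Lemma walls_cellular (U : Y -> set Y) : (forall p, open (U p)) -> (forall p, U p p) ->
  exists (s : seq Y) (m0 : nat), forall m, (m0 <= m)%N ->
  exists V : Y -> set Y, [/\ forall p, open (V p), forall p, V p `<=` U p,
    forall p q y, V p y -> V q y -> p = q,
    forall y, ~ walls m y -> exists2 p, p \in s & V p y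
    & forall p y, V p y -> ~ walls m y].
Proof.
move=> oU Up.
have /choice[h hP] := fun p => separate_open Ur r_gt0 r_cpt Ucont (oU p) (Up p).
have Uh p : Ustar d (h p) by have [] := hP p.
have cY : compact [set: Y].
  apply: compact_set_type; exact: (remainder_compact Ur r_gt0 r_cpt Ucont).
have [s sP] : exists s : seq Y, forall y, [set: Y] y ->
    exists2 p, p \in s & [set y | 1 < yhat (h p) y] y.
  apply: compact_fin_subcover cY _ _ => [p|y _].
    apply: (@open_comp _ _ (yhat (h p)) [set t | 1 < t]); last exact: open_gt.
    by move=> z _; exact: yhat_continuous.
  by exists y => /=; have [_ -> _] := hP y; lra.
exists s.
have third : 0 < 3^-1 :> R by rewrite invr_gt0.
have [delta delta0 hdelta] := common_modulus s third Uh.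
have [eta eta0 etaP] := d_small delta0.
exists (Num.truncn eta^-1).+1 => m m0m.
have meta : (2 ^+ m)^-1 < eta.
  rewrite invf_plt ?posrE ?exprn_gt0 //.
  apply: lt_le_trans (truncnS_gt _) _.
  rewrite -natrX ler_nat; apply: leq_trans m0m _; apply: ltnW; exact: ltn_expl.
have near x y : cell_label m x = cell_label m y -> r x < eta -> r y < eta ->
    d x y < delta.
  by move=> e rx ry; apply: etaP => // i; apply: lt_trans meta; exact: same_label.
(* p is admissible for the cell L if h p is large somewhere far out in the cell *)
pose good L p := p \in s /\ exists x, [/\ r x < eta, cell_label m x = L & 2 / 3 <= h p x].
(* each cell is assigned to one admissible p, if there is one *)
have /choice[sg sgP] : forall L, exists o : option Y,
   (forall p, o = Some p -> good L p) /\ (o = None -> forall p, ~ good L p).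
  move=> L; have [[p gp]|no] := pselect (exists p, good L p).
    by exists (Some p); split=> // q [<-].
  by exists None; split=> // _ p gp; apply: no; exists p.
(* g p is uniformly continuous because [wave_prod m] vanishes on the boundaries of the cells *)
pose g p x := if sg (cell_label m x) == Some p then wave_prod m x else 0.
have g_ge0 p x : 0 <= g p x by rewrite /g; case: ifP => // _; exact: wave_prod_ge0.
have g_le p x : g p x <= wave_prod m x.
  by rewrite /g; case: ifP => // _; exact: wave_prod_ge0.
have K0 : 0 < pi * 2 ^+ m :> R by rewrite mulr_gt0 ?pi_gt0 ?exprn_gt0.
have bump_d x y : cell_label m x <> cell_label m y ->
    wave_prod m x <= pi * 2 ^+ m * d x y.
  move=> ne; have [i ni] : exists i, cell_label m x i != cell_label m y i.
    apply: contrapT => no; apply: ne; apply: funext => i.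
    by apply/eqP; apply: contrapT => /negP ni; apply: no; exists i.
  apply: le_trans (wave_prod_le m x i) _; apply: le_trans (cos_pi_label ni) _.
  rewrite -mulrBr normrM (ger0_norm (exprn_ge0 _ _)) // mulrA.
  by rewrite ler_wpM2l // ltW.
have Ug p : Ustar d (g p).
  have /UstarP[[M bM] ub] := wave_prod_Ustar m.
  apply/UstarP; split.
    exists M => x; apply: le_trans (bM x); rewrite !ger0_norm ?wave_prod_ge0 //.
  move=> e e0; have [a a0 ba] := ub e e0.
  exists (Num.min a (e / (pi * 2 ^+ m))); first by rewrite lt_min a0 divr_gt0.
  move=> x y; rewrite lt_min => /andP[xa]; rewrite ltr_pdivlMr // mulrC => xb.
  have [l|l] := pselect (cell_label m x = cell_label m y).
    by rewrite /g l; case: ifP => _; rewrite ?subrr ?normr0 //; exact: ba.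
  have bx := bump_d x y l; have by_ : wave_prod m y <= pi * 2 ^+ m * d x y.
    have H : cell_label m y <> cell_label m x by move=> e'; apply: l.
    by rewrite d_sym; exact: bump_d.
  have gx := g_le p x; have gy := g_le p y; have gx0 := g_ge0 p x.
  by have gy0 := g_ge0 p y; rewrite ltr_norml; apply/andP; split; lra.
exists (fun p => [set y | 0 < yhat (g p) y]); split.
- move=> p; apply: (@open_comp _ _ (yhat (g p)) [set t | 0 < t]); last exact: open_gt.
  by move=> z _; exact: yhat_continuous.
- move=> p y /= gy; have [_ _] := hP p; apply.
  have Uh' : Ustar d (fun x => h p x + - 3^-1) by apply: Ustar_add => //; exact: Ustar_cst.
  have : 0 <= yhat (fun x => g p x * (h p x + - 3^-1)) y.
    apply: (hat_ge0 Ur r_gt0 r_cpt Ucont eta0); [exact: Ustar_mul| |exact: remainder_mem].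
    move=> x rx; rewrite /g; case: eqP => [e|_]; last by rewrite mul0r.
    have [/(_ p e)[ps [x' [rx' lx' hx']]] _] := sgP (cell_label m x).
    rewrite mulr_ge0 ?wave_prod_ge0 //.
    have := hdelta p x' x ps (near _ _ lx' rx' rx); rewrite ltr_norml; lra.
  rewrite /yhat (hat_mul Ur) // ?(hat_add Ur) ?(hat_cst Ur) //; try exact: remainder_mem; last exact: Ustar_cst.
  by rewrite -/(yhat _ _) pmulr_rge0 //; rewrite -/(yhat _ _); lra.
- move=> p q y /= py qy; apply/eqP; apply: contraT => pq.
  have : yhat (fun x => g p x * g q x) y = 0.
    rewrite (_ : (fun x => _) = fun=> 0) ?(hat_cst Ur) ///yhat ?(hat_cst Ur) //.
      exact: remainder_mem.
    apply: funext => x; rewrite /g; case: eqP => [->|_]; last by rewrite mul0r.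
    case: eqP => [[e]|_]; last by rewrite mulr0.
    by rewrite e eqxx in pq.
  rewrite /yhat (hat_mul Ur) //; last exact: remainder_mem.
  by move/eqP; rewrite mulf_eq0 => /orP[]/eqP e; [move: py|move: qy];
    rewrite /yhat e ltxx.
- move=> y /hat_wave_prod_gt0 by0.
  have [p0 p0s hp0] := sP y I.
  have Us : Ustar d (fun x => \sum_(p <- undup s) g p x) by exact: Ustar_sum.
  have Uc c : Ustar d (fun=> c : R) by exact: Ustar_cst.
  have U1 : Ustar d (fun x => h p0 x + - (2 / 3)) by exact: Ustar_add.
  have U2 : Ustar d (fun x => -1 * wave_prod m x).
    by apply: Ustar_mul => //; exact: wave_prod_Ustar.
  have U3 : Ustar d (fun x => \sum_(p <- undup s) g p x + -1 * wave_prod m x).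
    exact: Ustar_add.
  have sum_le x : \sum_(p <- undup s) g p x <= wave_prod m x.
    case e : (sg (cell_label m x)) => [p|]; last first.
      by rewrite big1 ?wave_prod_ge0 // => p _; rewrite /g e.
    have [ps|ps] := boolP (p \in undup s); last first.
      rewrite big1_seq ?wave_prod_ge0 // => q /andP[_ qs]; rewrite /g e.
      by case: eqP => // -[pq]; rewrite pq qs in ps.
    rewrite (big_rem p) //= big1_seq ?addr0 // => q /andP[_].
    rewrite mem_rem_uniq ?undup_uniq // inE => /andP[qp _]; rewrite /g e.
    by case: eqP => // -[pq]; rewrite pq eqxx in qp.
  (* far out, either h p0 is less than 2/3, or the cell is assigned and the sum of
     the g p is [wave_prod m] *)
  have : 0 <= yhat (fun x => (h p0 x + - (2 / 3)) *
      (\sum_(p <- undup s) g p x + -1 * wave_prod m x)) y.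
    apply: (hat_ge0 Ur r_gt0 r_cpt Ucont eta0); [exact: Ustar_mul| |exact: remainder_mem].
    move=> x rx; have [h1|h1] := leP (2 / 3) (h p0 x); last first.
      have := sum_le x => h2; rewrite nmulr_rge0; lra.
    suff -> : \sum_(p <- undup s) g p x = wave_prod m x by rewrite mulN1r subrr mulr0.
    have [s1 s2] := sgP (cell_label m x).
    case e : (sg (cell_label m x)) => [p|]; last first.
      by case: (s2 e p0); split=> //; exists x.
    have [ps _] := s1 p e.
    rewrite (big_rem p) ?mem_undup //= big1_seq ?addr0 /g ?e ?eqxx // => q /andP[_].
    rewrite mem_rem_uniq ?undup_uniq // inE => /andP[qp _].
    by case: eqP => // -[pq]; rewrite pq eqxx in qp.
  rewrite /yhat (hat_mul Ur) //; last exact: remainder_mem.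
  have Yy := remainder_mem y.
  rewrite !(hat_add Ur) // (hat_mul Ur) ?(hat_cst Ur) //; last exact: wave_prod_Ustar.
  rewrite (hat_sum Ur) // pmulr_rge0; last by move: hp0; rewrite /= /yhat; lra.
  move=> H; have : 0 < \sum_(p <- undup s) hat (g p) (set_val y).
    by move: by0; rewrite /yhat; lra.
  move=> pos; apply: contrapT => no; move: pos; apply/negP; rewrite -leNgt.
  rewrite big_seq; apply: sumr_le0 => p; rewrite mem_undup => ps.
  by rewrite leNgt; apply/negP => gp; apply: no; exists p.
- move=> p y /= gy; apply/hat_wave_prod_gt0; apply: lt_le_trans gy _.
  have Um : Ustar d (fun x => -1 * g p x) by apply: Ustar_mul => //; exact: Ustar_cst.
  have Ub := wave_prod_Ustar m.
  have : 0 <= yhat (fun x => wave_prod m x + -1 * g p x) y.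
    apply: (hat_ge0 Ur r_gt0 r_cpt Ucont eta0); [exact: Ustar_add| |exact: remainder_mem].
    by move=> x _; have := g_le p x; lra.
  have Yy := remainder_mem y.
  by rewrite /yhat (hat_add Ur) // (hat_mul Ur) ?(hat_cst Ur) //; [lra|exact: Ustar_cst].
Qed.
End Cells.

(** * Upper bounds for the dimensions *)

(** The sets [W m] cut the space into arbitrarily small disjoint open
    pieces. *)
Definition cellular (Y : topologicalType) (W : nat -> set Y) : Prop :=
  forall U : Y -> set Y, (forall p, open (U p)) -> (forall p, U p p) ->
  exists (s : seq Y) (m0 : nat), forall m, (m0 <= m)%N ->
  exists V : Y -> set Y, [/\ forall p, open (V p), forall p, V p `<=` U p,
    forall p q y, V p y -> V q y -> p = q,
    forall y, ~ W m y -> exists2 p, p \in s & V p y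
    & forall p y, V p y -> ~ W m y].

Lemma closed_image_set_val (E : topologicalType) (L : set E) (C : set L) :
  closed L -> closed C -> closed (set_val @` C).
Proof.
move=> cL cC; have [V oV VC] : open (~` C) by exact: closed_openC.
rewrite (_ : set_val @` C = L `&` ~` V).
  by apply: closedI => //; exact: open_closedC.
rewrite predeqE => x; split=> [[z Cz <-]|[Lx nVx]].
  split; first by apply: set_mem; exact: (valP z).
  by move=> Vz; have : (~` C) z by rewrite -VC.
exists (exist _ x (mem_set Lx)) => //; apply: contrapT => nC.
have : (~` C) (exist _ x (mem_set Lx)) by [].
by rewrite -VC.
Qed.

(** A space with a cellular sequence of sets such that no point lies in more
    than [n] of them has dimension at most [n], for [dim] and for [Ind]. *)
Section UpperBounds.
Variables (Y : topologicalType) (n : nat) (W : nat -> set Y).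
Hypothesis W_pigeonhole : forall (ms : seq nat) (y : Y), uniq ms ->
  (n < size ms)%N -> exists2 m, m \in ms & ~ W m y.
Hypothesis W_cells : cellular W.

(** The pieces of $n+1$ levels form the refinement: every point is off the
    walls of one level, and lies in at most one piece of each level. *)
Lemma cellular_dim_lt : dim_lt n.+1 Y.
Proof.
move=> U finU [oU cU].
have /choice[u uP] : forall p : Y, exists A : set Y, U A /\ A p.
  move=> p; have : [set: Y] p by [].
  by rewrite -cU => -[A UA Ap]; exists A.
have [|p|s [m0 sP]] := W_cells (U := u).
- by move=> p; apply: oU; case: (uP p).
- by case: (uP p).
have /choice[V VP] : forall l : nat, exists V : Y -> set Y, [/\ forall p, open (V p),
    forall p, V p `<=` u p, forall p q y, V p y -> V q y -> p = q,
    forall y, ~ W (m0 + l) y -> exists2 p, p \in s & V p y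
    & forall p y, V p y -> ~ W (m0 + l) y].
  by move=> l; apply: sP; exact: leq_addr.
pose D : set (nat * Y) := [set lp | (lp.1 < n.+1)%N /\ lp.2 \in s].
exists [set V lp.1 lp.2 | lp in D]; split.
- apply: finite_image.
  rewrite (_ : D = [set` [seq (l, p) | l <- iota 0 n.+1, p <- s]]).
    exact: finite_seq.
  rewrite predeqE => -[l p]; apply: (iff_trans _ (rwP allpairsP)).
  split=> [[ln ps]|[[l' p'] [+ ps [-> ->]]]].
    by exists (l, p); split=> //; rewrite mem_iota.
  by rewrite mem_iota.
- split; first by move=> _ [[l p] _ <-] /=; have [] := VP l.
  rewrite predeqE => y; split=> // _.
  have [||m] := W_pigeonhole (ms := iota m0 n.+1) y.
  + exact: iota_uniq.
  + by rewrite size_iota.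
  rewrite mem_iota => /andP[m0m mn] nW.
  have [_ _ _ + _] := VP (m - m0)%N; rewrite subnKC // => /(_ y nW)[p ps Vp].
  by exists (V (m - m0)%N p) => //; exists ((m - m0)%N, p) => //; split=> //=; lia.
- move=> _ [[l p] _ <-] /=; exists (u p); first by case: (uP p).
  by have [] := VP l.
- move=> F FV /card_esym/card_set_bijP[f [ff fi fs]].
  rewrite predeqE => y; split=> // yF.
  have /choice[g gP] : forall j : 'I_n.+2, exists lp : 'I_n.+1 * Y,
      f j = V lp.1 lp.2.
    move=> j; have /FV[[l p] [/= ln ps] e] := ff j (ltn_ord j).
    by exists (Ordinal ln, p).
  have Vy j : V (g j).1 (g j).2 y.
    by rewrite -gP; apply: yF; apply: ff; exact: ltn_ord.
  have inj : injective (fun j => (g j).1).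
    move=> j j' e; apply: val_inj; apply: fi; [exact/mem_set/ltn_ord..|].
    rewrite !gP; have Vj := Vy j; have Vj' := Vy j'; rewrite -e in Vj' *.
    by have [_ _ /(_ _ _ _ Vj Vj')-> _ _] := VP (g j).1.
  by have := leq_card _ inj; rewrite !card_ord ltnn.
Qed.

Hypothesis Y_normal : forall A B : set Y, closed A -> closed B -> A `&` B = set0 ->
  exists P Q : set Y, [/\ open P, open Q, A `<=` P, B `<=` Q & closure P `&` closure Q = set0].

(** Closed subspaces of [Y], up to homeomorphism. *)
Definition closed_embedding (E : topologicalType) (f : E -> Y) : Prop :=
  [/\ injective f, continuous f & forall A, closed A -> closed (f @` A)].

(** Induction on the codimension [size ms]: the partition is found in the
    walls of one further level [m], chosen fine enough and different from the
    levels [ms] already used. *)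
Lemma cellular_Ind_lt k (E : topologicalType) (f : E -> Y) (ms : seq nat) :
  closed_embedding f -> uniq ms -> (size ms + k)%N = n.+1 ->
  (forall e m, m \in ms -> W m (f e)) -> Ind_lt k E.
Proof.
elim: k E f ms => [|k IH] E f ms [fi fc fcl] ums sk fW /=.
  rewrite predeqE => e; split=> // _; rewrite addn0 in sk.
  have [|m mms] := W_pigeonhole (f e) ums; first by rewrite sk.
  by apply; exact: fW.
move=> A B cA cB AB0.
have [|P [Q [oP' oQ' AP BQ PQ]]] := Y_normal (fcl _ cA) (fcl _ cB).
  apply/seteqP; split=> // y [[a Aa fa] [b Bb fb]].
  have ba : b = a by apply: fi; rewrite fa fb.
  have : (A `&` B) a by split=> //; rewrite -ba.
  by rewrite AB0.
(* pieces around a point of the closure of Q avoid P, the other ones avoid Q *)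
pose U p := if pselect (closure Q p) then ~` closure P else ~` closure Q.
have [|p|s [m0 sP]] := W_cells (U := U).
- by move=> p; rewrite /U; case: (pselect (closure Q p)) => ?; apply: closed_openC; exact: closed_closure.
- rewrite /U; case: pselect => // Qp Pp.
  have : (closure P `&` closure Q) p by [].
  by rewrite PQ.
pose m := (m0 + (\max_(i <- ms) i).+1)%N.
have mms : m \notin ms.
  apply/negP => mm; have := @leq_bigmax_seq _ ms xpredT id m mm isT.
  by rewrite /m /=; lia.
have [V [oV VU Vd Wc Vw]] := sP m (leq_addr _ _).
pose VA : set Y := P `|` \bigcup_(p in ~` closure Q) V p.
pose VB : set Y := Q `|` \bigcup_(p in closure Q) V p.
have oA : open VA by apply: openU => //; exact: bigcup_open.
have oB : open VB by apply: openU => //; exact: bigcup_open.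
have VAB y : VA y -> VB y -> False.
  case=> [Py|[p Qp Vp]]; case=> [Qy|[q Qq Vq]].
  - have : (closure P `&` closure Q) y by split; exact: subset_closure.
    by rewrite PQ.
  - have := VU _ _ Vq; rewrite /U; case: (pselect (closure Q q)) => // ?; apply.
    exact: subset_closure.
  - have := VU _ _ Vp; rewrite /U; case: (pselect (closure Q p)) => // ?; apply.
    exact: subset_closure.
  - by apply: Qp; rewrite (Vd _ _ _ Vp Vq).
have VABc y : ~ W m y -> VA y \/ VB y.
  move=> /Wc[p _ Vp]; have [Qp|Qp] := pselect (closure Q p).
    by right; right; exists p.
  by left; right; exists p.
pose L : set E := f @^-1` (~` (VA `|` VB)).
have cL : closed L.
  apply: closed_comp => [e _|]; first exact: fc.
  by apply: open_closedC; exact: openU.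
exists L; split.
- split=> //; exists (f @^-1` VA), (f @^-1` VB); split; [split|split].
  + by apply: open_comp => // e _; exact: fc.
  + by apply: open_comp => // e _; exact: fc.
  + by move=> a Aa; left; apply: AP; exists a.
  + by move=> b Bb; left; apply: BQ; exists b.
  + by rewrite predeqE => e; split=> // -[]; exact: VAB.
  + by rewrite /L setCK.
- apply: (IH L (f \o set_val) (m :: ms)) => /=.
  + split.
    * by move=> x y /fi /val_inj.
    * move=> x; apply: continuous_comp; [exact: continuous_set_val|exact: fc].
    * move=> C cC; rewrite -image_comp; apply: fcl.
      exact: closed_image_set_val.
  + by rewrite mms.
  + by rewrite addSn -addnS.
  + move=> e m'; rewrite inE => /predU1P[->|]; last exact: fW.
    apply: contrapT => /VABc; have : L (set_val e) by apply: set_mem; exact: (valP e).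
    by [].
Qed.
End UpperBounds.

Lemma Ind_lt_ind_lt k (E : topologicalType) : (forall x : E, closed [set x]) ->
  Ind_lt k E -> ind_lt k E.
Proof.
elim: k E => [//|k IH] E E1 /= Ik x B cB nBx.
have [|L [pL iL]] := Ik [set x] B (E1 x) cB.
  by rewrite predeqE => y; split=> // -[->].
exists L; split=> //; apply: IH iL => y.
rewrite (_ : [set y] = set_val @^-1` [set set_val y]).
  by apply: closed_comp => // z _; exact: continuous_set_val.
by rewrite predeqE => z; split=> [->//|/val_inj].
Qed.

(** * The metric *)

Section MetricFacts.
Variables (R : realType) (X : topologicalType) (d : X -> X -> R).
Hypothesis md : is_metric d.

Lemma metric_refl x : d x x = 0.
Proof. exact/(is_metric_eq0 md). Qed.

Lemma metric_ge0 x y : 0 <= d x y.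
Proof.
have := is_metric_triangle md x y x; rewrite metric_refl (is_metric_sym md y x).
lra.
Qed.

Hypothesis cd : compatible d.

Lemma dball_nbhs x (e : R) : 0 < e -> nbhs x (dball d x e).
Proof. by move=> e0; rewrite cd; exists e. Qed.

Lemma nbhs_dball x A : nbhs x A -> exists2 e : R, 0 < e & dball d x e `<=` A.
Proof. by rewrite cd => -[e e0 eA]; exists e. Qed.

Lemma unif_continuous (f : X -> R) : dist_unif_continuous d f -> continuous f.
Proof.
move=> uf x; apply/cvgrPdist_lt => e e0; have [del del0 H] := uf e e0.
by apply: filterS (dball_nbhs x del0) => y /H.
Qed.

Lemma lip_continuous (f : X -> R) : (forall x y, `|f x - f y| <= d x y) ->
  continuous f.
Proof.
move=> fl; apply: unif_continuous => e e0; exists e => // x y.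
exact: le_lt_trans.
Qed.

Lemma dist_lip z x y : `|d z x - d z y| <= d x y.
Proof.
have := is_metric_triangle md z x y; have := is_metric_triangle md z y x.
rewrite (is_metric_sym md y x) ler_norml; lra.
Qed.

(** A positive 1-Lipschitz function vanishing at infinity: the supremum of
    weighted cones over a countable family of relatively compact balls, the
    weights tending to 0. *)
Lemma exhaustion : X -> locally_compact [set: X] -> separable X ->
  exists r : X -> R, [/\ forall x, 0 < r x, forall x, r x <= 1,
    forall x y, `|r x - r y| <= d x y &
    forall c, 0 < c -> compact [set x | c <= r x]].
Proof.
move=> x0 lc [D cD dD].
have /countable_injP[code codeI] := cD.
pose rad (m : nat) : R := m.+1%:R^-1.
have rad0 m : 0 < rad m by rewrite invr_gt0.
have rad1 m : rad m <= 1 by rewrite invf_le1 // ler1n.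
pose good a m := exists2 K : set X, compact K & dball d a (rad m) `<=` K.
pose S x : set R := [set t | exists a m, [/\ D a, good a m &
  t = (rad m - d a x) * rad (pickle (code a, m))]].
have S_le1 x t : S x t -> t <= 1.
  move=> [a [m [_ _ ->]]]; have := metric_ge0 a x; have := rad1 m.
  set u := rad m - _; have := rad1 (pickle (code a, m)).
  have := rad0 (pickle (code a, m)); set v := rad _ => v0 v1 h1 h2.
  have u1 : u <= 1 by rewrite /u; lra.
  have [u0|u0] := leP u 0; first by apply: (@le_trans _ _ 0) => //; rewrite pmulr_lle0.
  by rewrite -[leRHS]mulr1 ler_pM // ltW.
have S_pos x : exists2 t, S x t & 0 < t.
  have [U + [Uc _]] := lc x I; rewrite withinET => Un.
  have [e e0 eU] := nbhs_dball Un.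
  have [m me] : exists m, rad m < e / 2.
    exists (Num.truncn (e / 2)^-1); rewrite /rad invf_plt ?posrE ?divr_gt0 //.
    exact: truncnS_gt.
  have [|a [/interior_subset xa Da]] := dD (interior (dball d x (rad m))) _ (open_interior _).
    by exists x; apply: nbhs_singleton; apply: nbhs_interior; apply: dball_nbhs.
  have ax : d a x < rad m by rewrite (is_metric_sym md).
  exists ((rad m - d a x) * rad (pickle (code a, m))).
    exists a, m; split=> //; exists U => // y ay; apply: eU; rewrite /dball /= in xa ay *.
    have := is_metric_triangle md x a y; lra.
  by rewrite mulr_gt0 // subr_gt0.
have S_sup x : has_sup (S x).
  split; first by have [t St _] := S_pos x; exists t.
  by exists 1 => t; exact: S_le1.
pose r x := sup (S x).
have r_le x y : r x <= r y + d x y.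
  apply: ge_sup; first by case: (S_sup x).
  move=> _ [a [m [Da gam ->]]].
  apply: (@le_trans _ _ ((rad m - d a y) * rad (pickle (code a, m)) + d x y)).
    have := rad1 (pickle (code a, m)); have := rad0 (pickle (code a, m)).
    set v := rad (pickle _) => v0 v1.
    have tri := is_metric_triangle md a x y; have xy := metric_ge0 x y.
    have : (rad m - d a x) * v <= (rad m - d a y + d x y) * v.
      by rewrite ler_pM2r //; lra.
    have : d x y * v <= d x y by rewrite ler_piMr.
    lra.
  by rewrite lerD2r; apply: ub_le_sup; [case: (S_sup y)|exists a, m].
have r_lip x y : `|r x - r y| <= d x y.
  have := r_le x y; have := r_le y x; rewrite (is_metric_sym md y x) ler_norml; lra.
exists r; split=> //.
- move=> x; have [t St t0] := S_pos x; apply: lt_le_trans t0 _.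
  by apply: ub_le_sup => //; case: (S_sup x).
- move=> x; apply: ge_sup; first by case: (S_sup x).
  by move=> t; exact: S_le1.
- move=> c c0.
  (* K k is a compact set containing the ball with code k, if there is one *)
  have /choice[K KP] : forall k : nat, exists K : set X, compact K /\
      forall a m, D a -> pickle (code a, m) = k -> good a m -> dball d a (rad m) `<=` K.
    move=> k; have [[a [m [Da kam [K cK aK]]]]|no] :=
        pselect (exists a m, [/\ D a, pickle (code a, m) = k & good a m]).
      exists K; split=> // a' m' Da' kam' _.
      have [ca ->] : (code a', m') = (code a, m).
        by apply: (pcan_inj (@pickleK (nat * nat)%type)); rewrite kam kam'.
      by rewrite (codeI a' a (mem_set Da') (mem_set Da) ca).
    exists set0; split; first exact: compact0.
    by move=> a m Da kam g; case: no; exists a, m.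
  pose N := (Num.truncn (2 / c)).+1.
  have cK : compact (\bigcup_(k < N) K k).
    by rewrite bigcup_mkord; apply: bigsetU_compact => i _; case: (KP i).
  apply: (subclosed_compact _ cK).
    apply: (@closed_comp _ _ r [set t | c <= t]); last exact: closed_ge.
    by move=> x _; exact: lip_continuous.
  move=> x /= cx.
  have c2 : 0 < c / 2 by rewrite divr_gt0.
  have [_ [a [m [Da g ->]]]] := sup_adherent c2 (S_sup x).
  rewrite -/(r x); set v := rad (pickle _) => tv.
  have v0 : 0 < v by exact: rad0.
  have t2 : c / 2 < (rad m - d a x) * v by lra.
  have t0 : 0 < rad m - d a x.
    by rewrite -(pmulr_lgt0 _ v0); lra.
  exists (pickle (code a, m)); last first.
    have [_ /(_ a m Da erefl g)] := KP (pickle (code a, m)); apply.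
    by rewrite /dball /=; lra.
  have t1 : rad m - d a x <= 1 by have := rad1 m; have := metric_ge0 a x; lra.
  have v2 : c / 2 < v.
    apply: lt_le_trans t2 _; rewrite -[leRHS]mul1r ler_pM2r //.
  have : (pickle (code a, m)).+1%:R < 2 / c :> R.
    by move: v2; rewrite /v /rad -[c / 2]invrK ltf_pV2 ?posrE ?ltr0n ?invr_gt0 // invf_div.
  move=> h; rewrite /= -(ltr_nat R) /N.
  by have := truncnS_gt (2 / c); rewrite -!natr1 in h *; lra.
Qed.
End MetricFacts.

Section Construction.
Variables (R : realType) (X : topologicalType) (d0 : X -> X -> R) (n : nat).
Hypothesis md : is_metric d0.
Hypothesis cd : compatible d0.
Variable r : X -> R.
Hypothesis r_gt0 : forall x, 0 < r x.
Hypothesis r_le1 : forall x, r x <= 1.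
Hypothesis r_lip : forall x y, `|r x - r y| <= d0 x y.
Hypothesis r_cpt : forall c, 0 < c -> compact [set x | c <= r x].

(** With $f = 1/r$, the coordinates are $f$, $\cos f^2$, ..., $\cos f^{n+1}$. *)
Definition coordinate (i : 'I_n.+1) (x : X) : R :=
  if i == ord0 then (r x)^-1 else cos ((r x)^-1 ^+ i.+1).

(** A metric in which all points near infinity are close to each other. *)
Definition rho (x y : X) : R := Num.min (d0 x y) (r x + r y).

(** The metric of the theorem, in dimension [n.+1]. *)
Definition smirnov_dist (x y : X) : R :=
  rho x y + \sum_(i < n.+1) `|coordinate i x - coordinate i y|.

Lemma rho_ge0 x y : 0 <= rho x y.
Proof.
by rewrite /rho le_min (metric_ge0 md) addr_ge0 // ltW.
Qed.

Lemma rho_le x y : rho x y <= smirnov_dist x y.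
Proof. by rewrite /smirnov_dist lerDl sumr_ge0. Qed.

Lemma rho_triangle x y z : rho x z <= rho x y + rho y z.
Proof.
have := is_metric_triangle md x y z.
have := r_lip x y; have := r_lip y z; rewrite !ler_norml => /andP[h1 h2] /andP[h3 h4].
have := r_gt0 y; have := metric_ge0 md x y; have := metric_ge0 md y z.
rewrite /rho /Num.min; case: (ltP (d0 x z) _) => ?; case: (ltP (d0 x y) _) => ?;
  case: (ltP (d0 y z) _) => ?; lra.
Qed.

Lemma smirnov_dist_metric : is_metric smirnov_dist.
Proof.
split.
- move=> x y; split=> [e|->].
    have : rho x y <= 0 by rewrite -e; exact: rho_le.
    rewrite /rho ge_min => /orP[h|h].
      by apply/(is_metric_eq0 md)/eqP; rewrite eq_le h (metric_ge0 md).
    by move: h; rewrite leNgt addr_gt0.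
  rewrite /smirnov_dist big1 => [|i _]; last by rewrite subrr normr0.
  rewrite addr0 /rho (metric_refl md) min_l // addr_ge0 // ltW //.
- move=> x y; rewrite /smirnov_dist /rho (is_metric_sym md) addrC [in RHS]addrC addrC.
  rewrite (addrC (r y)) addrC; congr (_ + _).
  by apply: eq_bigr => i _; exact: distrC.
- move=> x y z; rewrite /smirnov_dist addrACA lerD ?rho_triangle //.
  rewrite -big_split /=; apply: ler_sum => i _.
  rewrite (_ : coordinate i x - coordinate i z =
    (coordinate i x - coordinate i y) + (coordinate i y - coordinate i z)); last by ring.
  exact: ler_normD.
Qed.

Lemma coordinate_lip i x y : `|coordinate i x - coordinate i y| <= smirnov_dist x y.
Proof.
rewrite /smirnov_dist (bigD1 i) //= addrCA lerDl addr_ge0 ?rho_ge0 //.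
exact: sumr_ge0.
Qed.

Lemma r_coordinate0 x : r x = (coordinate ord0 x)^-1.
Proof. by rewrite /coordinate eqxx invrK. Qed.

Lemma coordinate0_ge1 x : 1 <= coordinate ord0 x.
Proof. by rewrite /coordinate eqxx invf_ge1. Qed.

Lemma r_wdist_lip x y : `|r x - r y| <= 1 * smirnov_dist x y.
Proof.
rewrite mul1r; apply: le_trans (coordinate_lip ord0 x y).
rewrite !r_coordinate0; set a := coordinate _ x; set b := coordinate _ y.
have a1 : 1 <= a by exact: coordinate0_ge1.
have b1 : 1 <= b by exact: coordinate0_ge1.
have a0 : a != 0 by rewrite gt_eqF //; lra.
have b0 : b != 0 by rewrite gt_eqF //; lra.
have -> : a^-1 - b^-1 = (b - a) * (a^-1 * b^-1) by field; rewrite a0 b0.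
have ap : 0 < a by lra.
have bp : 0 < b by lra.
rewrite normrM distrC ler_piMr // ger0_norm; last first.
  by rewrite mulr_ge0 // invr_ge0 ltW.
by apply: mulr_ile1; rewrite ?invr_ge0 ?invf_le1 // ltW.
Qed.

Lemma r_wdist_Ustar : Ustar smirnov_dist r.
Proof.
apply: (Ustar_lip (M := 1) (metric_ge0 smirnov_dist_metric)) r_wdist_lip => x.
by rewrite gtr0_norm.
Qed.

Lemma r_continuous : continuous r.
Proof. exact: lip_continuous r_lip. Qed.

Lemma coordinate_continuous i : continuous (coordinate i).
Proof.
have ci : continuous (fun x => (r x)^-1).
  move=> x; apply: cvgV; first by rewrite gt_eqF.
  exact: r_continuous.
rewrite /coordinate; case: eqP => _ x; first exact: ci.
apply: (continuous_cvg _ (@continuous_cos R _)).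
by apply: (continuous_cvg _ (@exprn_continuous R i.+1 _)); exact: ci.
Qed.

Lemma smirnov_dist_compatible : compatible smirnov_dist.
Proof.
move=> x; rewrite predeqE => A; split=> [nA|[e /= e0 eA]].
  have [e e0 eA] := nbhs_dball cd nA.
  exists (Num.min e (r x)) => /=; first by rewrite lt_min e0 r_gt0.
  move=> y; rewrite /dball /= lt_min => /andP[h1 h2]; apply: eA; rewrite /dball /=.
  have := rho_le x y; have := r_gt0 y.
  rewrite /rho /Num.min; case: (ltP (d0 x y) _) => ?; lra.
apply: filterS eA _.
pose g y := d0 x y + \sum_(i < n.+1) `|coordinate i x - coordinate i y|.
have cg : continuous g.
  move=> y; apply: cvgD.
    exact: (lip_continuous cd (dist_lip md x)).
  have : continuous (fun y => \sum_(i < n.+1) `|coordinate i x - coordinate i y|).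
    apply: continuous_big; first exact: add_continuous.
    move=> i _ z; apply: (continuous_cvg _ (@norm_continuous _ _ _)).
    by apply: cvgB; [exact: cvg_cst|exact: coordinate_continuous].
  exact.
have : nbhs x [set y | g y < e].
  apply: open_nbhs_nbhs; split.
    apply: (@open_comp _ _ g [set t | t < e]); last exact: open_lt.
    by move=> y _; exact: cg.
  by rewrite /= /g (metric_refl md) add0r big1 // => i _; rewrite subrr normr0.
apply: filterS => y /=; apply: le_lt_trans; rewrite /smirnov_dist /g lerD2r.
by rewrite /rho ge_min lexx.
Qed.

Lemma smirnov_dist_proper : proper_metric smirnov_dist.
Proof.
move=> x s s0; have T1 := coordinate0_ge1 x.
have p0 : 0 < coordinate ord0 x + s by lra.
have c0 : 0 < (coordinate ord0 x + s)^-1 by rewrite invr_gt0.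
apply: (subclosed_compact _ (r_cpt c0)); first exact: closed_closure.
have cl : closed [set y | (coordinate ord0 x + s)^-1 <= r y].
  apply: (@closed_comp _ _ r [set t | _ <= t]); last exact: closed_ge.
  by move=> y _; exact: r_continuous.
rewrite ((closure_id _).1 cl); apply: closureS => y; rewrite /dball /= => xy.
rewrite r_coordinate0 lef_pV2 ?posrE //; last by have := coordinate0_ge1 y; lra.
have := coordinate_lip ord0 x y; rewrite ler_norml => /andP[]; lra.
Qed.

Lemma smirnov_dist_small (e : R) : 0 < e -> exists2 eta : R, 0 < eta &
  forall x y, r x < eta -> r y < eta ->
    (forall i, `|coordinate i x - coordinate i y| < eta) -> smirnov_dist x y < e.
Proof.
move=> e0; exists (e / (n.+1%:R + 2)) => [|x y rx ry H].
  by rewrite divr_gt0 // ltr_wpDl ?ler0n.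
set eta := e / _ in rx ry H *.
have -> : e = (n.+1%:R + 2) * eta.
  by rewrite /eta mulrC divfK // gt_eqF // ltr_wpDl ?ler0n.
have S : \sum_(i < n.+1) `|coordinate i x - coordinate i y| <= n.+1%:R * eta.
  rewrite (le_trans (ler_sum _ (fun i _ => ltW (H i)))) //.
  by rewrite sumr_const card_ord mulr_natl.
have : rho x y <= r x + r y by rewrite /rho ge_min lexx orbT.
rewrite /smirnov_dist mulrDl; lra.
Qed.

Hypothesis X_noncompact : ~ compact [set: X].
Hypothesis X_connected : connected [set: X].

(** The first coordinate is continuous and unbounded on a connected space. *)
Lemma coordinate0_onto : exists A : R, forall t, A <= t -> exists x, coordinate ord0 x = t.
Proof.
have [x0] : exists x : X, True.
  apply: contrapT => no; apply: X_noncompact.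
  by rewrite (_ : [set: X] = set0) ?predeqE; [exact: compact0|
    move=> x; split=> // _; apply: no; exists x].
move=> _; exists (coordinate ord0 x0) => t xt.
have [x1 tx1] : exists x, t <= coordinate ord0 x.
  apply: contrapT => no; apply: X_noncompact.
  have t0 : 0 < t^-1 by rewrite invr_gt0; have := coordinate0_ge1 x0; lra.
  have := r_cpt t0; rewrite (_ : [set x | _] = setT) // predeqE => x; split=> // _ /=.
  have T0 := coordinate0_ge1 x0; have Tx := coordinate0_ge1 x.
  rewrite r_coordinate0 lef_pV2 ?posrE; [|lra|lra].
  by rewrite leNgt; apply/negP => h; apply: no; exists x; exact: ltW.
have : connected (coordinate ord0 @` setT).
  apply: connected_continuous_connected => //.
  by apply: continuous_subspaceT; exact: coordinate_continuous.
move/connected_intervalP => /(_ (coordinate ord0 x0) (coordinate ord0 x1)).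
case/(_ _ _ t) => //; try by eexists.
  by rewrite xt tx1.
by move=> x _ <-; exists x.
Qed.
End Construction.

(** * Cubes in the remainder *)

Lemma cosD2pi_nat (R : realType) (x : R) (k : nat) : cos (x + 2 * pi * k%:R) = cos x.
Proof.
elim: k => [|k IH]; first by rewrite mulr0 addr0.
rewrite -[k.+1%:R]natr1 (_ : _ + _ = (x + 2 * pi * k%:R) + pi *+ 2); last by rewrite mulr2n; ring.
by rewrite cosD2pi.
Qed.

Lemma root_exists (R : realType) (k : nat) (s u : R) : 0 <= s -> s ^+ k.+1 <= u ->
  exists2 t, s <= t & t ^+ k.+1 = u.
Proof.
move=> s0 su.
have u0 : 0 <= u by apply: le_trans su; rewrite exprn_ge0.
have [] := @IVT R (fun t => t ^+ k.+1) s (s + 1 + u) u.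
- by lra.
- by apply: continuous_subspaceT => x; exact: exprn_continuous.
- rewrite ge_min su /= le_max; apply/orP; right.
  apply: (@le_trans _ _ (s + 1 + u)); first lra.
  by rewrite exprS ler_peMr ?exprn_ege1 //; lra.
- by move=> t; rewrite in_itv /= => /andP[st _] e; exists t.
Qed.

Lemma cos_onto_above (R : realType) (s y : R) : 0 <= s -> -1 <= y <= 1 ->
  exists u, [/\ s <= u, u <= s + 4 * pi & cos u = y].
Proof.
move=> s0 y1; have [/andP[a0 api] ac] := acos_def y1.
have p0 : 0 < 2 * pi :> R by rewrite mulr_gt0 ?pi_gt0.
pose k := (Num.truncn (s / (2 * pi))).+1.
exists (acos y + 2 * pi * k%:R); rewrite cosD2pi_nat.
have h1 : s / (2 * pi) < k%:R by exact: truncnS_gt.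
have h2 : (Num.truncn (s / (2 * pi)))%:R <= s / (2 * pi).
  by rewrite truncn_le // divr_ge0 // ltW.
have h3 : k%:R - 1 <= s / (2 * pi) by rewrite /k -natr1 addrK.
rewrite ltr_pdivrMr // in h1; rewrite ler_pdivlMr // in h3.
have pp := pi_gt0 R.
by split=> //; lra.
Qed.

(** If $t^j-s^j\le c$ then the smaller powers of [s] and [t] differ by at most
    $c/s$; this makes $\cos t^j$ oscillate while the $\cos t^i$ with $i<j$ are
    almost constant. *)
Lemma power_gap (R : realType) (i j : nat) (s t c : R) : (i < j)%N -> 1 <= s -> s <= t ->
  t ^+ j - s ^+ j <= c -> t ^+ i - s ^+ i <= c / s.
Proof.
move=> ij s1 st tc; have s0 : 0 < s by lra.
have t0 : 0 <= t by lra.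
rewrite ler_pdivlMr //; apply: le_trans tc.
have ki : (j = (j - i) + i)%N by lia.
rewrite ki !exprD; set k := (j - i)%N.
have st_i : s ^+ i <= t ^+ i by apply: lerXn2r; rewrite ?nnegrE // ltW.
have sk : s <= s ^+ k by rewrite -{1}[s]expr1; apply: ler_weXn2l => //; lia.
have tk : s ^+ k <= t ^+ k by apply: lerXn2r; rewrite ?nnegrE // ltW.
apply: (@le_trans _ _ (s ^+ k * (t ^+ i - s ^+ i))).
  by rewrite mulrC ler_wpM2r // subr_ge0.
rewrite mulrBr lerD2r ler_wpM2r // exprn_ge0 //.
Qed.

(** The curve $(t,\cos t^2,\dots,\cos t^{m+1})$ is asymptotically dense in
    $[0,\infty)\times[-1,1]^m$. *)
Lemma cos_density (R : realType) (m : nat) (e : R) : 0 < e ->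
  exists A : R, forall t0, A <= t0 -> forall y : nat -> R, (forall i, -1 <= y i <= 1) ->
  exists t, [/\ t0 <= t, t < t0 + e &
    forall i, (1 <= i <= m)%N -> `|cos (t ^+ i.+1) - y i| < e].
Proof.
elim: m e => [|m IH] e e0.
  by exists 0 => t0 _ y _; exists t0; split=> //; [lra|move=> i; lia].
have e2 : 0 < e / 2 by lra.
have pp := pi_gt0 R.
have [A AP] := IH _ e2; exists (Num.max A (1 + 4 * pi / (e / 2))) => t0.
rewrite ge_max => /andP[At0 pt0] y y1.
have pe : 0 <= 4 * pi / (e / 2) by rewrite divr_ge0 ?mulr_ge0 ?ltW.
have [s [t0s ste sP]] := AP t0 At0 y y1.
have s1 : 1 <= s by lra.
have gap : 4 * pi / s < e / 2.
  rewrite ltr_pdivrMr; last lra.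
  have : 4 * pi / (e / 2) < s by lra.
  by rewrite ltr_pdivrMr // [s * _]mulrC.
have [|u [su us uy]] := @cos_onto_above R (s ^+ m.+2) (y m.+1) _ (y1 m.+1).
  by rewrite exprn_ge0 //; lra.
have [|t st tu] := @root_exists R m.+1 s u _ su; first by lra.
have tgap i : (i < m.+2)%N -> t ^+ i - s ^+ i < e / 2.
  move=> im; apply: le_lt_trans gap.
  by apply: (power_gap im) => //; rewrite tu; lra.
exists t; split; first lra.
  by have := tgap 1%N isT; rewrite !expr1; lra.
move=> i /andP[i1]; rewrite leq_eqVlt => /predU1P[->|im].
  by rewrite tu uy subrr normr0.
have ii : (1 <= i <= m)%N by rewrite i1 -ltnS.
have := sP i ii; have := cos_lipschitz (t ^+ i.+1) (s ^+ i.+1).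
rewrite [X in _ <= X]ger0_norm; last first.
  by rewrite subr_ge0; apply: lerXn2r; rewrite ?nnegrE //; lra.
have := tgap i.+1; rewrite ltnS im => /(_ isT) h1 h2 h3.
rewrite (_ : _ - y i = (cos (t ^+ i.+1) - cos (s ^+ i.+1)) + (cos (s ^+ i.+1) - y i)); last by ring.
by apply: le_lt_trans (ler_normD _ _) _; lra.
Qed.

Lemma continuous_dist (R : realType) (Z : topologicalType) (f g : Z -> R) :
  continuous f -> continuous g -> continuous (fun z => `|f z - g z|).
Proof. by move=> cf cg z; apply: cvg_norm; apply: cvgB; [exact: cf|exact: cg]. Qed.

(** [T_dense]: arbitrarily far out, the coordinates fill a translate of the
    unit cube up to [eta].  The translation vectors are even, so that they are
    periods of $\cos(\pi x)$. *)
Section Embedding.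
Variables (R : realType) (X : topologicalType) (d : X -> X -> R) (r : X -> R).
Variables (n : nat) (T : 'I_n -> X -> R).
Hypothesis Ur : Ustar d r.
Hypothesis r_gt0 : forall x, 0 < r x.
Hypothesis r_cpt : forall c, 0 < c -> compact [set x | c <= r x].
Hypothesis Ucont : forall f, Ustar d f -> continuous f.
Hypothesis d_ge0 : forall x y, 0 <= d x y.
Hypothesis T_lip : forall i x y, `|T i x - T i y| <= d x y.
Hypothesis d_small : forall e : R, 0 < e -> exists2 eta : R, 0 < eta &
  forall x y, r x < eta -> r y < eta -> (forall i, `|T i x - T i y| < eta) ->
    d x y < e.
Hypothesis T_dense : forall eta : R, 0 < eta -> exists a : 'I_n -> nat,
  forall q : 'rV[R]_n, cube R n q -> exists x, r x < eta /\
    forall i, `|T i x - (q ord0 i + 2 * (a i)%:R)| < eta.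
Local Notation Y := (smirnov_remainder d).
Local Notation M := 'rV[R]_n.
Local Notation Q := {ptws (M * Ustar d)%type -> R}.

(** A map [xi] from the space of the cube to [X], encoded by the values of all
    the functions of [Ustar d] at all its points. *)
Definition scatter (xi : M -> X) : Q := fun qf => set_val qf.2 (xi qf.1).

(** [xi] follows, up to [eta], a translated cube located where [r] is less
    than [eta]. *)
Definition approximates (eta : R) (xi : M -> X) : Prop :=
  exists a : 'I_n -> nat, forall q, cube R n q -> r (xi q) < eta /\
    forall i, `|T i (xi q) - (q ord0 i + 2 * (a i)%:R)| < eta.

Lemma approximates_exists eta : 0 < eta -> exists xi, approximates eta xi.
Proof.
move=> eta0; have [a aP] := T_dense eta0.
have [x0 _] : exists x, r x < eta /\ forall i,
    `|T i x - ((0 : M) ord0 i + 2 * (a i)%:R)| < eta.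
  by apply: aP => i; rewrite mxE lexx ler01.
have /choice[xi xiP] : forall q, exists x, cube R n q -> r x < eta /\
    forall i, `|T i x - (q ord0 i + 2 * (a i)%:R)| < eta.
  move=> q; have [/aP[x xP]|nq] := pselect (cube R n q); first by exists x.
  by exists x0.
by exists xi, a.
Qed.

(** A cluster point of the encoded maps, by Tychonoff's theorem. *)
Lemma limit_exists : exists E : Q, forall eta : R, 0 < eta ->
  closure (scatter @` approximates eta) E.
Proof.
pose F : set_system Q :=
  filter_from [set eta : R | 0 < eta] (fun eta => scatter @` approximates eta).
have FF : ProperFilter F.
  apply: filter_from_proper; last first.
    by move=> eta /= /approximates_exists[xi xiP]; exists (scatter xi), xi.
  apply: filter_from_filter; first by exists 1 => /=; exact: ltr01.
  move=> a b /= a0 b0; exists (Num.min a b) => /=; first by rewrite lt_min a0.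
  move=> _ [xi [k kP] <-]; split; exists xi => //; exists k => q /kP[rq Tq].
    by split=> [|i]; [move: rq|move: (Tq i)]; rewrite lt_min => /andP[].
  by split=> [|i]; [move: rq|move: (Tq i)]; rewrite lt_min => /andP[].
have /choice[B BP] : forall f : Ustar d, exists B, forall x, `|set_val f x| <= B.
  move=> f; have /UstarP[[B BP] _] : Ustar d (set_val f).
    by apply: set_mem; exact: (valP f).
  by exists B.
have cK := @tychonoff (M * Ustar d)%type (fun=> R)
  (fun qf => `[- B qf.2, B qf.2]%classic) (fun qf => @segment_compact R _ _).
have [|E [_ clE]] := cK F FF.
  exists 1 => [|_ [xi _ <-]] /=; first exact: ltr01.
  by move=> qf; rewrite /= in_itv /= -ler_norml; exact: BP.
exists E => eta eta0 N EN; apply: clE => //; exists eta => //.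
Qed.

(** The limit of approximating maps embeds the unit cube in the remainder: it
    is continuous because functions of [Ustar d] are equicontinuous along these
    maps, and injective because the extension of $\cos(\pi T_i)$ takes the value
    $\cos(\pi q_i)$ at the image of [q]. *)
Lemma cube_embeds : exists phi : cube R n -> Y, continuous phi /\ injective phi.
Proof.
have [E EP] := limit_exists.
have Ein (A : set Q) (eta : R) : 0 < eta -> closed A ->
    (forall xi, approximates eta xi -> A (scatter xi)) -> A E.
  move=> eta0 cA HA; apply: cA; apply: closureS (EP _ eta0).
  by move=> _ [xi xiP <-]; exact: HA.
pose ev (q : M) : {ptws Ustar d -> R} := fun f => E (q, f).
pose val_at (q : M) (f : X -> R) (G : Q) : R := hat f ((fun g => G (q, g)) : {ptws Ustar d -> R}).
have val_cont q f : continuous (val_at q f).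
  rewrite /val_at /hat; case: pselect => [h|_]; last exact: cst_continuous.
  exact: (@proj_continuous _ (fun _ : (M * Ustar d)%type => R)).
have val_scatter q f xi : Ustar d f -> val_at q f (scatter xi) = f (xi q).
  by move=> Uf; rewrite /val_at /hat; case: pselect.
have small (a : R) : (forall eta : R, 0 < eta -> `|a| <= eta) -> a = 0.
  move=> H; apply/eqP; rewrite -normr_eq0 eq_le normr_ge0 andbT.
  by apply/ler_addgt0Pl => e e0; rewrite addr0; exact: H.
have bound q f (c eta : R) (l : R) : 0 < eta -> Ustar d f ->
    (forall xi, approximates eta xi -> `|f (xi q) - l| <= c) ->
    `|hat f (ev q) - l| <= c.
  move=> eta0 Uf H.
  apply: (@Ein [set G | `|val_at q f G - l| <= c] eta) => //.
    apply: (@closed_comp _ _ (fun G => `|val_at q f G - l|) [set t | t <= c]);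
      last exact: closed_le.
    by move=> G _; apply: continuous_dist; [exact: val_cont|exact: cst_continuous].
  by move=> xi xiP /=; rewrite val_scatter //; exact: H.
have evY q : cube R n q -> Y (ev q).
  move=> Cq; rewrite (remainderE Ur r_gt0 r_cpt Ucont); split.
    rewrite smirnov_closure => N Nq.
    pose ga : Q -> {ptws Ustar d -> R} := fun G => fun f => G (q, f).
    have gac : continuous ga.
      apply: continuous_to_ptws => f.
      exact: (@proj_continuous _ (fun _ : (M * Ustar d)%type => R)).
    have [_ [[xi _ <-] Nxi]] := EP 1 ltr01 _ (gac E N Nq).
    by exists (smirnov_eval d (xi q)); split=> //; exists (xi q).
  apply: small => eta eta0; rewrite -[hat _ _]subr0.
  apply: (bound _ _ _ _ _ eta0 Ur) => xi [a /(_ q Cq)[rq _]].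
  by rewrite subr0 gtr0_norm // ltW.
have Uw i : Ustar d (wave T 0 i) by exact: wave_Ustar.
have ev_wave q i : cube R n q -> hat (wave T 0 i) (ev q) = cos (pi * q ord0 i).
  move=> Cq; apply/eqP; rewrite -subr_eq0; apply/eqP; apply: small => eta eta0.
  have pp := pi_gt0 R.
  have ep : 0 < eta / pi by rewrite divr_gt0.
  apply: (bound _ _ _ _ _ ep) => // xi [a /(_ q Cq)[_ /(_ i) Ti]].
  have -> : cos (pi * q ord0 i) = cos (pi * (q ord0 i + 2 * (a i)%:R)).
    by rewrite mulrDr mulrA [pi * 2]mulrC cosD2pi_nat.
  apply: le_trans (cos_lipschitz _ _) _; rewrite expr0 mul1r -mulrBr normrM gtr0_norm //.
  by rewrite mulrC -ler_pdivlMr // ltW.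
have ev_unif f (e : R) : Ustar d f -> 0 < e -> exists2 del : R, 0 < del &
    forall q q', cube R n q -> cube R n q' -> ball q del q' ->
      `|hat f (ev q) - hat f (ev q')| <= e.
  move=> Uf e0; have /UstarP[_ /(_ e e0)[del del0 fdel]] := Uf.
  have [eta eta0 etaP] := d_small del0.
  have eta3 : 0 < eta / 3 by lra.
  exists (eta / 3) => // q q' Cq Cq' [_ qq'].
  apply: (@Ein [set G | `|val_at q f G - val_at q' f G| <= e] (eta / 3)) => //.
    apply: (@closed_comp _ _ (fun G => `|val_at q f G - val_at q' f G|) [set t | t <= e]);
      last exact: closed_le.
    by move=> G _; apply: continuous_dist; exact: val_cont.
  move=> xi [a aP] /=; rewrite !val_scatter //; apply: ltW; apply: fdel.
  have [r1 T1] := aP q Cq; have [r2 T2] := aP q' Cq'.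
  apply: etaP; [lra|lra|move=> i].
  have := T1 i; have := T2 i; have := qq' ord0 i; rewrite -ball_normE /= !ltr_norml.
  lra.
have phiP (q : cube R n) : ev (set_val q) \in Y.
  by apply: mem_set; apply: evY; apply: set_mem; exact: (valP q).
have Cval (q : cube R n) : cube R n (set_val q) by apply: set_mem; exact: (valP q).
exists (fun q => exist _ (ev (set_val q)) (phiP q)); split.
- apply/(@continuousP _ Y) => A [B oB <-]; rewrite -comp_preimage.
  have /continuousP : continuous (fun q : cube R n => ev (set_val q)).
    apply: continuous_to_ptws => f q; apply/(@cvgrPdist_le _ _ _ (nbhs q) (nbhs_filter q)) => e e0.
    have Uf : Ustar d (set_val f) by apply: set_mem; exact: (valP f).
    have [del del0 H] := ev_unif _ _ Uf e0.
    have : nbhs q (set_val @^-1` ball (set_val q) del : set (cube R n)).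
      by apply: continuous_set_val; exact: nbhsx_ballx.
    by apply: filterS => q' /= /H; rewrite !hatE; apply.
  exact.
- move=> q q' /(congr1 set_val) h; apply: val_inj; apply/rowP => i.
  have e : ev (set_val q) = ev (set_val q') := h.
  have pp := pi_gt0 R.
  have := ev_wave _ i (Cval q); rewrite e ev_wave // => /esym/cos_inj.
  have [/andP[a0 a1] /andP[b0 b1]] := (Cval q i, Cval q' i).
  have inpi (t : R) : 0 <= t -> t <= 1 -> pi * t \in `[0, pi].
    move=> t0 t1; rewrite in_itv /=; apply/andP; split.
      by apply: mulr_ge0 => //; exact: pi_ge0.
    by apply: ler_piMr => //; exact: pi_ge0.
  by move/(_ (inpi _ a0 a1) (inpi _ b0 b1))/(mulfI (lt0r_neq0 pp)).
Qed.
End Embedding.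

(** * Lower bounds from an embedded compact set *)

Section Lower.
Variables (R : realType) (M : normedModType R).

(** The topology of [F] is induced by [phi]. *)
Definition embeds (F : set M) (Y : topologicalType) (phi : F -> Y) : Prop :=
  (forall H : set Y, open H -> exists2 G : set M, open G &
     forall x, G (set_val x) <-> H (phi x)) /\
  (forall G : set M, open G -> exists2 H : set Y, open H &
     forall x, G (set_val x) <-> H (phi x)).

(** A continuous injection of a compact set in a Hausdorff space is a closed
    embedding. *)
Lemma compact_embeds (C : set M) (Y : topologicalType) (phi : C -> Y) :
  compact C -> hausdorff_space Y -> continuous phi -> injective phi ->
  closed (range phi) /\ embeds phi.
Proof.
move=> cC hY cphi iphi.
have cphiA (A : set C) : closed A -> closed (phi @` A).
  move=> cA; apply: compact_closed hY _; apply: continuous_compact.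
    exact: continuous_subspaceT.
  apply: subclosed_compact cA (compact_set_type cC) _; exact: subsetT.
split; first by apply: cphiA; exact: closedT.
split=> [H oH|G oG].
  have [G oG GH] : open (phi @^-1` H) by apply: open_comp => // x _; exact: cphi.
  by exists G => // x; rewrite -[H (phi x)]/((phi @^-1` H) x) -GH.
exists (~` (phi @` (~` (set_val @^-1` G)))).
  apply: closed_openC; apply: cphiA; apply: open_closedC.
  by apply: open_comp => // x _; exact: continuous_set_val.
move=> x; split=> [Gx [y nGy /iphi yx]|nim]; first by apply: nGy; rewrite yx.
by apply: contrapT => nG; apply: nim; exists x.
Qed.

Lemma ind_lt_sind_lt k (F : set M) (Y : topologicalType) (phi : F -> Y) :
  embeds phi -> ind_lt k Y -> sind_lt k F.
Proof.
elim: k F Y phi => [|k IH] F Y phi [phi1 phi2] /=.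
  move=> Y0; apply/seteqP; split=> // x Fx.
  have : [set: Y] (phi (exist _ x (mem_set Fx))) by [].
  by rewrite Y0.
move=> iY x G Fx oG Gx; pose xF : F := exist _ x (mem_set Fx).
have [H oH HP] := phi2 G oG.
have [||L [[cL [U [V [[oU oV xU BV] [UV0 LUV]]]]] iL]] := iY (phi xF) (~` H).
- exact: open_closedC.
- by apply; apply/HP.
have [GU oGU GUP] := phi1 U oU; have [GV oGV GVP] := phi1 V oV.
have LP y : ~ U y -> ~ V y -> L y.
  move=> nU nV; apply: contrapT => nL.
  have : (~` L) y by []. 
  by rewrite LUV => -[].
exists GU, GV; split=> //.
- by apply/(GUP xF); exact: xU.
- move=> z [Fz nGz]; apply/(GVP (exist _ z (mem_set Fz))); apply: BV.
  by move=> /HP.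
- split.
    apply/seteqP; split=> // z [Fz [/(GUP (exist _ z (mem_set Fz))) Uz]].
    move=> /(GVP (exist _ z (mem_set Fz))) Vz.
    have : (U `&` V) (phi (exist _ z (mem_set Fz))) by [].
    by rewrite UV0.
  have inF (z : (F `\` (GU `|` GV))) : set_val z \in F.
    by apply: mem_set; have [] : (F `\` (GU `|` GV)) (set_val z)
      by apply: set_mem; exact: (valP z).
  pose inc (z : (F `\` (GU `|` GV))) : F := exist _ (set_val z) (inF z).
  have inL (z : (F `\` (GU `|` GV))) : phi (inc z) \in L.
    apply: mem_set.
    have [_ nUV] : (F `\` (GU `|` GV)) (set_val z) by apply: set_mem; exact: (valP z).
    by apply: LP => h; apply: nUV; [left; apply/(GUP (inc z))|right; apply/(GVP (inc z))].
  apply: (IH _ L (fun z => exist _ (phi (inc z)) (inL z))) => //; split.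
    move=> _ [W oW <-]; have [K oK KP] := phi1 W oW; exists K => // z.
    exact: (KP (inc z)).
  move=> K oK; have [W oW WP] := phi2 K oK; exists (set_val @^-1` W).
    by exists W.
  by move=> z; exact: (WP (inc z)).
Qed.

(** The open sets of the cover of [C] are traces of open sets of [Y], to
    which the complement of the image is added; the members of a refinement are
    then grouped according to a member of the cover that contains them. *)
Lemma dim_lt_shrinkable n (C : set M) (Y : topologicalType) (phi : C -> Y) :
  closed (range phi) -> embeds phi -> dim_lt n Y -> shrinkable 'I_n.+1 C C n.
Proof.
move=> cphi [phi1 phi2] dY U oU CU.
have /choice[H HP] : forall j, exists H : set Y, open H /\
    forall x, U j (set_val x) <-> H (phi x).
  by move=> j; have [H oH HP] := phi2 _ (oU j); exists H.
pose UU : set (set Y) := [set ~` range phi] `|` range H.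
have [||VV [finV [oV cV] VU mV]] := dY UU.
- by rewrite finite_setU; split; [exact: finite_set1|
    apply: finite_image; exact: finite_finset].
- split; first by move=> A [->|[j _ <-]]; [exact: closed_openC|case: (HP j)].
  apply/seteqP; split=> // y _; have [[x _ xy]|ny] := pselect (range phi y).
    have [j Uj] : exists j, U j (set_val x).
      by apply: CU; apply: set_mem; exact: (valP x).
    exists (H j); first by right; exists j.
    by rewrite -xy; case: (HP j) => _ /(_ x)[+ _]; exact.
  by exists (~` range phi) => //; left.
(* the index of a set H j containing B, with the default value ord0 *)
have /choice[kap kapP] : forall B : set Y, exists j : 'I_n.+1,
    (exists j, B `<=` H j) -> B `<=` H j.
  move=> B; have [[j Bj]|no] := pselect (exists j, B `<=` H j); first by exists j.
  by exists ord0.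
pose V j : set M := U j `&` \bigcup_(G in [set G | open G /\
  exists B, [/\ VV B, kap B = j & forall x, G (set_val x) <-> B (phi x)]]) G.
have VB (x : C) j : V j (set_val x) -> exists B, [/\ VV B, kap B = j & B (phi x)].
  by move=> [_ [G [_ [B [VB kB GB]]] Gx]]; exists B; split=> //; apply/GB.
exists V; split.
- move=> j; apply: openI => //; apply: bigcup_open => G [oG _]; exact: oG.
- by move=> j x [].
- move=> x Cx; pose xC : C := exist _ x (mem_set Cx).
  have : [set: Y] (phi xC) by [].
  rewrite -cV => -[B VB_ Bx].
  have Bj : exists j, B `<=` H j.
    have [A [->|[j _ <-]] BA] := VU B VB_; last by exists j.
    by case: (BA _ Bx); exists xC.
  have Hk := kapP B Bj.
  exists (kap B); split.
    by case: (HP (kap B)) => _ /(_ xC)[_]; apply; exact: Hk.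
  have [G oG GP] := phi1 B (oV B VB_).
  exists G; last by apply/(GP xC).
  by split=> //; exists B.
- move=> x Cx; pose xC : C := exist _ x (mem_set Cx).
  rewrite leqNgt; apply/negP => big.
  have all j : V j x.
    have : #|[pred j | `[< V j x >]]| = #|'I_n.+1|.
      apply/eqP; rewrite eqn_leq max_card /= card_ord; exact: big.
    move=> /fintype.subset_cardP /(_ (subset_predT _)) e.
    have : j \in [pred j | `[< V j x >]] by rewrite e.
    by move=> /asboolP.
  have /choice[B BP] := fun j => VB xC j (all j).
  have iB : injective B.
    by move=> j j' e; have [_ <- _] := BP j; have [_ <- _] := BP j'; rewrite e.
  suff : (\bigcap_(A in range B) A) (phi xC).
    rewrite (mV (range B)) //; first by move=> _ [j _ <-]; case: (BP j).
    rewrite (_ : range B = (fun k => B (inord k)) @` `I_n.+1); last first.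
      apply/seteqP; split=> [_ [j _ <-]|_ [k _ <-]]; last by exists (inord k).
      by exists j => /=; [exact: ltn_ord|rewrite inord_val].
    apply: inj_card_eq => k k' /set_mem kn /set_mem kn' /iB.
    by move=> /(congr1 val); rewrite /= !inordK.
  by move=> _ [j _ <-]; case: (BP j).
Qed.
End Lower.

(** * The dimension of the remainder *)

(** In a normal space, disjoint closed sets have neighbourhoods with disjoint
    closures. *)
Lemma normal_closures (Y : topologicalType) : normal_space Y ->
  forall A B : set Y, closed A -> closed B -> A `&` B = set0 ->
  exists P Q : set Y, [/\ open P, open Q, A `<=` P, B `<=` Q & closure P `&` closure Q = set0].
Proof.
move=> nY A B cA cB AB0.
have [|A' nA' A'B] := nY A cA (~` B).
  apply/set_nbhsP; exists (~` B); split => //; first exact: closed_openC.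
  exact/disjoints_subset.
have [|B' nB' B'A] := nY B cB (~` closure A').
  apply/set_nbhsP; exists (~` closure A'); split => //.
    by apply: closed_openC; exact: closed_closure.
  by move=> y By /A'B.
exists (interior A'), (interior B'); split; try exact: open_interior.
- exact: nA'.
- exact: nB'.
apply/seteqP; split=> // y [Ay By].
apply: (B'A y); last first.
  by apply: closureS Ay; exact: interior_subset.
by apply: closureS By; exact: interior_subset.
Qed.

(** The coordinates of the metric [smirnov_dist] satisfy the density condition used
    to embed cubes in the remainder. *)
Lemma smirnov_dist_dense (R : realType) (X : topologicalType) (d0 : X -> X -> R) (n : nat)
    (r : X -> R) : compatible d0 -> (forall x, 0 < r x) ->
  (forall x, r x <= 1) -> (forall x y, `|r x - r y| <= d0 x y) ->
  (forall c, 0 < c -> compact [set x | c <= r x]) ->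
  ~ compact [set: X] -> connected [set: X] ->
  forall eta : R, 0 < eta -> exists a : 'I_n.+1 -> nat,
  forall q : 'rV[R]_n.+1, cube R n.+1 q -> exists x, r x < eta /\
    forall i, `|coordinate r i x - (q ord0 i + 2 * (a i)%:R)| < eta.
Proof.
move=> cd r0 r1 rl rc Xnc Xc eta eta0.
have [A AP] := coordinate0_onto n cd r0 r1 rl rc Xnc Xc.
have [B BP] := cos_density n eta0.
pose k := (Num.truncn (`|A| + `|B| + eta^-1)).+1.
have kb : `|A| + `|B| + eta^-1 < k%:R by exact: truncnS_gt.
have e0 : 0 < eta^-1 by rewrite invr_gt0.
have := ler_norm A; have := ler_norm B; have := normr_ge0 A; have := normr_ge0 B.
move=> B0 A0 BB AA.
exists (fun i => if i == ord0 then k else 0%N) => q Cq.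
have [||t [t1 t2 tP]] := BP (q ord0 ord0 + 2 * k%:R) _ (fun i => q ord0 (inord i)).
- by have := Cq ord0; lra.
- by move=> i; have := Cq (inord i); lra.
have q0 := Cq ord0.
have [|x xt] := AP t; first by lra.
have rx : (r x)^-1 = t by rewrite -xt /coordinate eqxx.
exists x; split.
  rewrite -[r x]invrK rx invf_plt ?posrE //; lra.
move=> i; have [->|i0] := eqVneq i ord0.
  by rewrite xt ger0_norm; lra.
rewrite /coordinate (negbTE i0) rx mulr0 addr0.
have := tP i; rewrite inord_val; apply.
by apply/andP; split; [rewrite lt0n | rewrite -ltnS].
Qed.

Theorem theorem2p7 (R : realType) (X : topologicalType)
    (X_noncompact : ~ compact [set: X])
    (X_locally_compact : locally_compact [set: X])
    (X_connected : connected [set: X])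
    (X_separable : separable X)
    (X_metrizable : metrizable R X)
    (n : nat) (n_ge1 : (1 <= n)%N) :
  exists d : X -> X -> R,
    [/\ is_metric d, compatible d & proper_metric d] /\
    [/\ dim_eq (smirnov_remainder d) n,
        ind_eq (smirnov_remainder d) n
      & Ind_eq (smirnov_remainder d) n].
Proof.
case: n n_ge1 => // n _.
have [d0 [md cd]] := X_metrizable.
have [x0 _] : exists x : X, True.
  apply: contrapT => no; apply: X_noncompact.
  rewrite (_ : [set: X] = set0); first exact: compact0.
  by apply/seteqP; split=> // x _; apply: no; exists x.
have [r [r0 r1 rl rc]] := exhaustion md cd x0 X_locally_compact X_separable.
pose d := smirnov_dist d0 n r; pose T := @coordinate R X n r.
have dm : is_metric d by exact: smirnov_dist_metric.
have dc : compatible d by exact: smirnov_dist_compatible.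
have dp : proper_metric d by exact: smirnov_dist_proper.
have d_ge0 := metric_ge0 dm.
have Ur : Ustar d r by exact: r_wdist_Ustar.
have Uc f : Ustar d f -> continuous f.
  by move=> /UstarP[_]; exact: unif_continuous.
have Tl i x y : `|T i x - T i y| <= d x y by exact: coordinate_lip.
have ds : forall e : R, 0 < e -> exists2 eta : R, 0 < eta &
  forall x y, r x < eta -> r y < eta -> (forall i, `|T i x - T i y| < eta) ->
    d x y < e by exact: smirnov_dist_small.
have Td := smirnov_dist_dense n cd r0 r1 rl rc X_noncompact X_connected.
exists d; split=> //.
set Y := smirnov_remainder d.
have hY : hausdorff_space Y := @remainder_hausdorff R X d.
have cY : compact [set: Y].
  by apply: compact_set_type; exact: remainder_compact Ur r0 rc Uc.
have T1 (y : Y) : closed [set y].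
  by apply: accessible_closed_set1; exact: hausdorff_accessible.
have nY := normal_closures (compact_normal hY cY).
have pig := walls_pigeonhole Ur r0 rc Uc d_ge0 Tl.
have cel : cellular (walls T) := walls_cellular Ur r0 rc Uc d_ge0 (is_metric_sym dm) Tl ds.
have up_dim : dim_lt n.+2 Y by exact: cellular_dim_lt pig cel.
have up_Ind : Ind_lt n.+2 Y.
  apply: (cellular_Ind_lt pig cel nY (f := id) (ms := [::])) => //.
  by split=> // [y|A cA]; [exact: cvg_id|rewrite image_id].
have [phi [cphi iphi]] := cube_embeds Ur r0 rc Uc d_ge0 Tl ds Td.
have [rphi ephi] := compact_embeds (@cube_compact R n.+1) hY cphi iphi.
have lo_dim : ~ dim_lt n.+1 Y.
  by move=> /(dim_lt_shrinkable rphi ephi); exact: cube_not_shrinkable.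
have lo_ind : ~ ind_lt n.+1 Y.
  move=> /(ind_lt_sind_lt ephi) si; apply: (@cube_not_shrinkable R n.+1).
  apply: sind_shrinkable si => //; first exact: cube_compact.
  by apply: compact_closed (@cube_compact R n.+1); exact: norm_hausdorff.
split; split=> //; first exact: Ind_lt_ind_lt.
by move=> /(Ind_lt_ind_lt T1).
Qed.
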